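(* Suppose $\mathcal{H}$ is a hereditary $3$-graph property and $\text{Trip}(\mathcal{H})$ contains $k\otimes U(k)$ for all $k\geq 1$. Then for some $K,K'>0$, $Tw(\epsilon^{-K})\leq M_{\mathcal{H}}(\epsilon)\leq Tw(\epsilon^{-K'})$ for all sufficiently small $\epsilon>0$.
   Context: $3$-graphs are $H=(V,E)$ with $E\subseteq\binom V3$; a hereditary $3$-graph property is a class of finite $3$-graphs closed under isomorphism and induced sub-$3$-graphs. $d_H(X,Y,Z)=|\{(x,y,z)\in X\times Y\times Z:\{x,y,z\}\in E\}|/(|X||Y||Z|)$. A triple $(X,Y,Z)$ is $\epsilon$-regular if $|d_H(X,Y,Z)-d_H(X',Y',Z')|\le\epsilon$ for all $X'\subseteq X,Y'\subseteq Y,Z'\subseteq Z$ of sizes at least $\epsilon|X|,\epsilon|Y|,\epsilon|Z|$; a partition $\mathcal P$ of $V$ is $\epsilon$-regular if at least $(1-\epsilon)|V|^3$ triples of $V^3$ lie in some $\epsilon$-regular $X\times Y\times Z$ with $(X,Y,Z)\in\mathcal P^3$. $M_{\mathcal H}(\epsilon)$ is the least $M$ such that all sufficiently large members of $\mathcal H$ have $\epsilon$-regular partitions with at most $M$ parts. $Tw(1)=1$, $Tw(i)=2^{Tw(i-1)}$. For a $3$-graph $H=(V,E)$, $\text{Trip}(H)$ has vertex set $\{x_v\}\cup\{y_v\}\cup\{z_v\}$ ($v\in V$) and edges $x_vy_{v'}z_{v''}$ for $vv'v''\in E$; $\text{Trip}(\mathcal H)$ is the closure of $\{\text{Trip}(H):H\in\mathcal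 H\}$ under isomorphism and induced sub-$3$-graphs. $U(k)$ is the bipartite graph with parts $\{a_1,\dots,a_k\}$ and $\{b_S:S\subseteq[k]\}$ and edges $a_ib_S$ for $i\in S$. For a bipartite graph $G=(U\cup V,E)$ and $n\ge1$, $n\otimes G$ is the $3$-graph with vertex set $U\cup V\cup\{c_1,\dots,c_n\}$ ($c_i$ new) and edges $\{c_i,u,w\}$ for $i\in[n]$, $uw\in E$. *)

(* Defs.v *)
From Stdlib Require Import Reals ClassicalEpsilon.
From mathcomp Require Import all_boot.

Set Implicit Arguments.
Unset Strict Implicit.
Unset Printing Implicit Defensive.

Definition pb (P : Prop) : bool :=
  if excluded_middle_informative P then true else false.

Definition is3graph (V : finType) (E : {set {set V}}) : Prop :=
  forall e, e \in E -> #|e| = 3.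

(* A 3-graph property, represented on the canonical vertex sets 'I_n
   (closure under isomorphism makes this representation complete). *)
Definition prop3 := forall n : nat, {set {set 'I_n}} -> Prop.

(* hereditary: members are 3-graphs, and the class is closed under isomorphism
   and induced sub-3-graphs, i.e. under pulling back along injections. *)
Definition hereditary3 (P : prop3) : Prop :=
  forall n (E : {set {set 'I_n}}), P n E ->
    is3graph E /\
    forall m (f : 'I_m -> 'I_n), injective f ->
      P m [set e : {set 'I_m} | f @: e \in E].

Local Open Scope R_scope.

Definition dens (V : finType) (E : {set {set V}}) (X Y Z : {set V}) : R :=
  (INR #|[set t : V * V * V | (t.1.1 \in X) && (t.1.2 \in Y) && (t.2 \in Z)
            && ([set t.1.1; t.1.2; t.2] \in E)]|
   / (INR #|X| * INR #|Y| * INR #|Z|)).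

Definition reg_triple (V : finType) (E : {set {set V}}) (eps : R)
  (X Y Z : {set V}) : Prop :=
  forall X' Y' Z' : {set V},
    X' \subset X -> Y' \subset Y -> Z' \subset Z ->
    (eps * INR #|X| <= INR #|X'|) ->
    (eps * INR #|Y| <= INR #|Y'|) ->
    (eps * INR #|Z| <= INR #|Z'|) ->
    (Rabs (dens E X Y Z - dens E X' Y' Z') <= eps).

Definition reg_partition (V : finType) (E : {set {set V}}) (eps : R)
  (Q : {set {set V}}) : Prop :=
  partition Q [set: V] /\
  (((1 - eps) * INR #|V| ^ 3) <=
    INR #|[set t : V * V * V | pb (exists X Y Z : {set V},
        [/\ X \in Q, Y \in Q, Z \in Q,
            (t.1.1 \in X) && (t.1.2 \in Y) && (t.2 \in Z)
          & reg_triple E eps X Y Z])]|).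

Local Close Scope R_scope.

Definition MH_admissible (P : prop3) (eps : R) (M : nat) : Prop :=
  exists N, forall n (E : {set {set 'I_n}}), P n E -> N <= n ->
    exists Q : {set {set 'I_n}}, reg_partition E eps Q /\ #|Q| <= M.

Definition is_MH (P : prop3) (eps : R) (M : nat) : Prop :=
  MH_admissible P eps M /\ forall M', MH_admissible P eps M' -> M <= M'.

(* tower function: Tw 1 = 1, Tw (i+1) = 2 ^ Tw i (Tw 0 := 1 as a convention) *)
Fixpoint Tw (i : nat) : nat :=
  match i with
  | 0 => 1
  | 1 => 1
  | S j => 2 ^ Tw j
  end.

(* ceiling of a real number, as a nat (0 for negatives) *)
Definition ceilR (x : R) : nat := Z.to_nat (- Int_part (Ropp x))%Z.

Definition TwR (x : R) : nat := Tw (ceilR x).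

(* Trip(H) for H on 'I_n: vertices 'I_3 * 'I_n, (0,v)=x_v, (1,v)=y_v, (2,v)=z_v *)
Definition trip_edges n (E : {set {set 'I_n}}) : {set {set 'I_3 * 'I_n}} :=
  [set [set ((inord 0 : 'I_3), t.1.1); ((inord 1 : 'I_3), t.1.2);
            ((inord 2 : 'I_3), t.2)]
    | t in [set t : 'I_n * 'I_n * 'I_n | [set t.1.1; t.1.2; t.2] \in E]].

Definition trip_contains (P : prop3) (W : finType) (EW : {set {set W}}) : Prop :=
  exists n (E : {set {set 'I_n}}), P n E /\
    exists f : W -> 'I_3 * 'I_n, injective f /\
      forall e : {set W}, (e \in EW) = (f @: e \in trip_edges E).

(* k (x) U(k): vertices a_i = inl (inl i), b_S = inl (inr S), c_i = inr i;
   edges {c_i, a_j, b_S} with j \in S *)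
Definition kUk_vertex (k : nat) : finType := ('I_k + {set 'I_k} + 'I_k)%type.

Definition kUk_edges (k : nat) : {set {set kUk_vertex k}} :=
  [set [set (inr t.2 : kUk_vertex k); inl (inl t.1.1); inl (inr t.1.2)]
    | t in [set t : 'I_k * {set 'I_k} * 'I_k | t.1.1 \in t.1.2]].

(* Main.v *)
(** Lower bound, after the Moshkovitz-Shapira proof of Gowers' theorem.  Take
    nested equipartitions of a set, the (r+1)-st having exponentially many more
    clusters than the r-th: the children of a level r cluster are the words of
    an error-correcting code closed under complement, whose j-th bit bipartitions
    the cluster for its interaction with the j-th level r cluster.  The r-th
    graph joins x and y when they lie on the same side of each other's
    bipartitions, and G is the average of the s graphs.  If a part Z of a
    regular partition is concentrated on one level r cluster but spread over its
    children, then many bipartitions split Z; against half of the matching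
    cluster the two pieces have densities differing by exactly 1/s, because the
    earlier graphs are constant there and the later ones have density exactly
    1/2.  That half is mostly covered by parts W of the other side, so a constant
    times 1/s of the W are irregular with Z.  Hence by induction on r nearly all
    parts are concentrated on single level r clusters for all r <= s, and there
    are at least as many parts as a tower of height about s, where s is a power
    of 1/eps.

    The average is turned into a 0/1 bipartite graph by blowing up and letting a
    function u : V -> [s] at x, evaluated at a coordinate v of y, choose which of
    the s graphs is used.  Every bipartite graph embeds, through U(k), in a member
    of P as the common link of a third set of vertices of the same size; edges
    inside the three sets or between two of them are irrelevant since a regular
    triple is only tested on subsets of the three sets.

    Upper bound: the usual energy increment, each step refining a partition
    into q parts by at most 3 q^3 witnesses of irregularity. *)
Require Import Defs.
From Stdlib Require Import Reals.
From Stdlib Require Import ClassicalEpsilon.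
From mathcomp Require Import all_boot.
From mathcomp Require Import order ssralg ssrnum archimedean.
From mathcomp Require Import Rstruct ring lra zify.

Set Implicit Arguments.
Unset Strict Implicit.
Unset Printing Implicit Defensive.

Import Order.TTheory GRing.Theory Num.Theory.

(** * Nested equipartitions and the averaged graph *)

Section ClusterSystem.

Variables (T : finType) (s : nat) (m : nat -> nat).
Variables (chi : nat -> T -> nat) (side : nat -> T -> nat -> bool).

Definition cluster r i : {set T} := [set x | chi r x == i].

Definition half r i j : {set T} := [set x in cluster r i | side r x j].

(** Between two clusters the edges form two disjoint complete bipartite graphs, one on the [true]
    halves and one on the [false] halves. *)
Definition level_edge r x y : bool :=
  side r x (chi r y) == side r y (chi r x).

(** [chi r x] is the index of the level [r] cluster of [x], and [side r x j] is its side in the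
    bipartition of that cluster used against the [j]-th cluster. The last field is the code
    distance: two children of one cluster are separated by at least an eighth of the
    bipartitions. *)
Record cluster_system : Prop := ClusterSystem {
  chi_lt : forall r x, (r <= s)%N -> (chi r x < m r)%N;
  card_cluster : forall r i, (r <= s)%N -> (i < m r)%N ->
    (#|cluster r i| * m r = #|T|)%N;
  chi_refines : forall r x y, (r < s)%N ->
    chi r.+1 x = chi r.+1 y -> chi r x = chi r y;
  side_cluster : forall r x y j, (r < s)%N ->
    chi r.+1 x = chi r.+1 y -> side r x j = side r y j;
  card_half : forall r i j, (r < s)%N -> (i < m r)%N -> (j < m r)%N ->
    (2 * #|half r i j| = #|cluster r i|)%N;
  side_separates : forall r x y, (r < s)%N ->
    chi r x = chi r y -> chi r.+1 x <> chi r.+1 y ->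
    (m r <= 8 * #|[set j : 'I_(m r) | side r x j != side r y j]|)%N }.

Hypothesis sys : cluster_system.

Lemma level_edgeC r x y : level_edge r x y = level_edge r y x.
Proof. by rewrite /level_edge eq_sym. Qed.

Lemma chi_refines_le r r' x y : (r <= r' <= s)%N ->
  chi r' x = chi r' y -> chi r x = chi r y.
Proof.
elim: r' => [|r' IH] /andP[]; first by rewrite leqn0 => /eqP ->.
rewrite leq_eqVlt => /orP[/eqP -> //|rr'] r's E.
apply: IH; first by rewrite -ltnS rr' ltnW.
exact: chi_refines sys _ _ _ r's E.
Qed.

Lemma chi_side_refines r r' x y j : (r < r' <= s)%N ->
  chi r' x = chi r' y -> side r x j = side r y j.
Proof.
case/andP=> rr' r's E; apply: (side_cluster sys); first exact: leq_trans r's.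
by apply: chi_refines_le E; rewrite rr'.
Qed.

(** As [r' > r], the set [half r j i] is a union of level [r'] clusters, and in each of them the
    neighbours of [x] form exactly one of the two equal sides facing the cluster of [x]. *)
Lemma card_later_edges r r' i j x : (r < r' < s)%N -> (j < m r)%N ->
  (2 * #|[set y in half r j i | level_edge r' x y]| = #|half r j i|)%N.
Proof.
case/andP=> rr' r's jm.
have r's' := ltnW r's.
pose p y := Ordinal (chi_lt sys y r's').
have H k : (2 * (\sum_(y in half r j i | level_edge r' x y && (p y == k)) 1) =
            \sum_(y in half r j i | p y == k) 1)%N.
  have [[y0 /andP[y0A /eqP Ey0]]|none] :
     (exists y, (y \in half r j i) && (p y == k)) \/
     (forall y, (y \in half r j i) && (p y == k) = false).
  - case: (pickP (fun y => (y \in half r j i) && (p y == k))) => [y Hy|]; last by right.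
    by left; exists y.
  (* A level [r'] cluster that meets the half lies inside it. *)
  - have ink y : (y \in half r j i) && (p y == k) = (y \in cluster r' k).
      rewrite /cluster inE; apply/andP/eqP => [[_ /eqP <- //]|Ey].
      have E : chi r' y = chi r' y0 by rewrite Ey -Ey0.
      split; last by apply/eqP/val_inj.
      move: y0A; rewrite !inE.
      have -> : chi r y = chi r y0 by apply: chi_refines_le E; rewrite (ltnW rr').
      by rewrite (chi_side_refines (r':=r') _ _ E) ?rr'.
    have Hh : (2 * #|half r' k (chi r' x)| = #|cluster r' k|)%N.
      by apply: (card_half sys r's); [exact: ltn_ord | exact: (chi_lt sys)].
    under eq_bigl do rewrite andbCA andbC ink -/(level_edge _ _ _).
    rewrite (eq_bigl _ _ ink) sum1_card.
    case Es: (side r' x k).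
    + rewrite -Hh; congr (2 * _)%N.
      rewrite sum1dep_card; apply: eq_card => y; rewrite !inE.
      case: eqP => //= Ey; by rewrite /level_edge Ey Es; case: side.
    + rewrite sum1dep_card.
      have -> : #|[set y | (y \in cluster r' k) && level_edge r' x y]| =
                (#|cluster r' k| - #|half r' k (chi r' x)|)%N.
        rewrite -(@cardsID _ (half r' k (chi r' x)) (cluster r' k)).
        rewrite (setIidPr _); last by apply/subsetP=> y; rewrite inE => /andP[? _].
        rewrite addKn; apply: eq_card => y; rewrite !inE.
        case: eqP => //= Ey; by rewrite /level_edge Ey Es; case: side.
      by rewrite -Hh; lia.
  - rewrite !big1 // => y; first by rewrite none.
    by rewrite andbCA none andbF.
rewrite -[RHS]sum1_card -sum1dep_card.
rewrite (partition_big p predT) //= big_distrr /=.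
rewrite [RHS](partition_big p predT) //=.
apply: eq_bigr => k _; rewrite -(H k); congr (2 * _)%N.
by apply: eq_bigl => y; rewrite andbA.
Qed.

Lemma sum_bool_card (I : finType) (A : {set I}) (b : pred I) :
  (\sum_(y in A) b y)%N = #|[set y in A | b y]|.
Proof. by rewrite -sum1dep_card big_mkcondr; apply: eq_bigr => y _; case: b. Qed.

Local Open Scope ring_scope.
Variable F : realFieldType.

Definition edge_weight x y : F :=
  (\sum_(r < s) (level_edge r x y)%:R) / s%:R.

Lemma edge_weightC x y : edge_weight x y = edge_weight y x.
Proof. by congr (_ / _); apply: eq_bigr => r _; rewrite level_edgeC. Qed.

Lemma edge_weight01 x y : 0 <= edge_weight x y <= 1.
Proof.
have [s0|s0] := posnP s.
  by rewrite /edge_weight s0 invr0 mulr0 lexx ler01.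
rewrite divr_ge0 ?ler0n ?sumr_ge0 //=.
rewrite ler_pdivrMr ?ltr0n // mul1r.
rewrite (@le_trans _ _ (\sum_(r < s) 1)) //.
  by apply: ler_sum => r _; case: level_edge.
by rewrite sumr_const card_ord.
Qed.

(** Only level [r] survives: there [x] is joined to the whole half and [x'] to none of it. At
    earlier levels the two have the same neighbours, and at later levels each is joined to exactly
    half of the half. *)
Lemma edge_weight_half r i j x x' : (r < s)%N -> (j < m r)%N ->
  chi r x = i -> chi r x' = i -> side r x j -> ~~ side r x' j ->
  \sum_(y in half r j i) (edge_weight x y - edge_weight x' y) =
  #|half r j i|%:R / s%:R.
Proof.
move=> rs jm xi x'i sx sx'.
under eq_bigr => y _ do rewrite -mulrBl -sumrB.
rewrite -mulr_suml exchange_big /=; congr (_ / _).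
rewrite (bigD1 (Ordinal rs)) //= [X in _ + X]big1 => [|r' r'r].
  rewrite addr0 -sumr_const; apply: eq_bigr => y; rewrite !inE.
  case/andP=> /eqP yj sy.
  by rewrite /level_edge xi x'i yj sx sy (negbTE sx') subr0.
have ne : nat_of_ord r' != r by apply: contra r'r => /eqP E; apply/eqP/val_inj.
case: (ltngtP r' r) => [lt|lt|E]; last by rewrite E eqxx in ne.
- apply: big1 => y _; rewrite /level_edge.
  have E : chi r x = chi r x' by rewrite xi.
  have -> : chi r' x = chi r' x' by apply: chi_refines_le E; rewrite (ltnW lt) (ltnW rs).
  by rewrite (chi_side_refines (r':=r) _ _ E) ?subrr // lt (ltnW rs).
- have C z : (2 * \sum_(y in half r j i) level_edge r' z y)%N = #|half r j i|.
    by rewrite sum_bool_card card_later_edges // lt /=.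
  rewrite sumrB -!natr_sum.
  suff -> : (\sum_(y in half r j i) level_edge r' x y =
            \sum_(y in half r j i) level_edge r' x' y)%N by rewrite subrr.
  by have := C x; have := C x'; lia.
Qed.

(* For x in Z0, the pairs (x', j) with x' in a different child cluster and on
   the other side of the j-th bipartition have density at least 1/8, while an
   unbalanced j contributes little; the sum is normalized by the number of
   such x' so that each summand is at most 1. *)
Lemma many_balanced_splits r i (Z0 : {set T}) (t : F) :
  (r < s)%N -> 0 < t -> Z0 \subset cluster r i ->
  (forall k, #|Z0 :&: cluster r.+1 k|%:R + t <= #|Z0|%:R) ->
  (m r)%:R <= 16%:R * #|[set j : 'I_(m r) |
     (t <= 32%:R * #|[set x in Z0 | side r x j]|%:R) &&
     (t <= 32%:R * #|[set x in Z0 | ~~ side r x j]|%:R)]|%:R :> F.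
Proof.
move=> rs t0 Z0i Ht; set J := [set j | _].
pose R_ x := [set x' in Z0 | chi r.+1 x' != chi r.+1 x].
pose a x j := #|[set x' in R_ x | side r x' j != side r x j]|.
have RE x : #|R_ x|%:R = #|Z0|%:R - #|Z0 :&: cluster r.+1 (chi r.+1 x)|%:R :> F.
  rewrite -(cardsID (cluster r.+1 (chi r.+1 x)) Z0) natrD addrAC subrr add0r.
  by congr (_%:R); apply: eq_card => y; rewrite !inE andbC.
have Rt x : t <= #|R_ x|%:R by rewrite RE; have := Ht (chi r.+1 x); lra.
have R0 x : 0 < #|R_ x|%:R :> F by apply: lt_le_trans (Rt x).
have Z0t : t <= #|Z0|%:R.
  by apply: le_trans (Ht 0%N); rewrite lerDr ler0n.
have Z0p : 0 < #|Z0|%:R :> F by exact: lt_le_trans Z0t.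
pose S := \sum_(x in Z0) \sum_(j < m r) (a x j)%:R / #|R_ x|%:R : F.
have S1 : #|Z0|%:R * (m r)%:R <= 8%:R * S.
  rewrite /S mulr_sumr -sumr_const mulr_suml.
  apply: ler_sum => x xZ; rewrite mul1r -mulr_suml mulrA ler_pdivlMr //.
  rewrite -natr_sum -!natrM ler_nat.
  have -> : (\sum_(j < m r) a x j =
     \sum_(x' in R_ x) #|[set j : 'I_(m r) | side r x' j != side r x j]|)%N.
    transitivity (\sum_(j < m r) \sum_(x' in R_ x) (side r x' j != side r x j))%N.
      by apply: eq_bigr => j _; rewrite sum_bool_card.
    rewrite exchange_big /=; apply: eq_bigr => x' _.
    by rewrite -sum1dep_card [RHS]big_mkcond /=; apply: eq_bigr => j _; case: (_ != _).
  rewrite mulnC -sum_nat_const big_distrr /=; apply: leq_sum => x'.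
  rewrite inE => /andP[x'Z /eqP ne].
  apply: (side_separates sys) => //.
  move/subsetP: Z0i => Z0i; move: (Z0i _ xZ) (Z0i _ x'Z); rewrite !inE.
  by move=> /eqP -> /eqP ->.
have ale x j : (a x j)%:R / #|R_ x|%:R <= 1 :> F.
  rewrite ler_pdivrMr // mul1r ler_nat; apply: subset_leq_card.
  by apply/subsetP=> y; rewrite inE => /andP[].
(* Fewer than [t/32] vertices lie on the minority side [b], each contributing at most 1. A vertex on
   the other side has fewer than [t/32] opponents among the at least [t] elements of [R_ x], so it
   contributes at most 1/32. *)
have unbal j (b : bool) : 32%:R * #|[set x in Z0 | side r x j == b]|%:R < t ->
    \sum_(x in Z0) (a x j)%:R / #|R_ x|%:R <= #|Z0|%:R / 16%:R :> F.
  move=> lt.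
  rewrite (bigID (fun x => side r x j == b)) /=.
  have -> : #|Z0|%:R / 16%:R = #|Z0|%:R / 32%:R + #|Z0|%:R / 32%:R :> F by field.
  apply: lerD.
    apply: le_trans (_ : \sum_(x in Z0 | side r x j == b) 1 <= _).
      by apply: ler_sum => x _; apply: ale.
    by rewrite sumr_const -(@eq_card _ [set x in Z0 | side r x j == b]) => [|x];
      [lra|rewrite inE].
  apply: le_trans (_ : \sum_(x in Z0 | side r x j != b) 32%:R^-1 <= _).
    apply: ler_sum => x /andP[xZ sb].
    rewrite ler_pdivrMr //.
    have : (a x j)%:R <= #|[set x in Z0 | side r x j == b]|%:R :> F.
      rewrite ler_nat; apply: subset_leq_card; apply/subsetP=> y.
      rewrite !inE => /andP[/andP[-> _]] /=.
      by case: (side r y j) (side r x j) b sb {lt} => [] [] [].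
    by have := Rt x; lra.
  rewrite big_mkcondr /= -sumr_const mulr_suml; apply: ler_sum => x _.
  by case: ifP => _; lra.
have S2 : S <= #|J|%:R * #|Z0|%:R + (m r)%:R * (#|Z0|%:R / 16%:R).
  rewrite /S exchange_big /= (bigID [in J]) /=; apply: lerD.
    rewrite mulr_natl -sumr_const; apply: ler_sum => j _.
    by rewrite -sumr_const; apply: ler_sum => x _; exact: ale.
  apply: le_trans (_ : \sum_(j < m r | j \notin J) (#|Z0|%:R / 16%:R) <= _).
    apply: ler_sum => j; rewrite inE negb_and -!ltNge => /orP[lt|lt].
      apply: (unbal j true); rewrite (@eq_card _ _ [set x in Z0 | side r x j]) //.
      by move=> x; rewrite !inE eqb_id.
    apply: (unbal j false); rewrite (@eq_card _ _ [set x in Z0 | ~~ side r x j]) //.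
    by move=> x; rewrite !inE eqbF_neg.
  rewrite big_mkcond /=.
  apply: le_trans (_ : \sum_(j < m r) (#|Z0|%:R / 16%:R) <= _); last first.
    by rewrite sumr_const card_ord (mulr_natl (_ / _)).
  by apply: ler_sum => j _; case: ifP => // _; rewrite divr_ge0.
(* Inserting [S2] into [S1] gives an error of half the left side, which is absorbed. *)
have : #|Z0|%:R * (m r)%:R <= 16%:R * #|J|%:R * #|Z0|%:R :> F by lra.
by rewrite mulrC ler_pM2r.
Qed.

End ClusterSystem.

(** * Regular parts concentrate on clusters *)

Section Concentration.

Variables (T L : finType) (s : nat) (m : nat -> nat).
Variables (chi : nat -> T -> nat) (side : nat -> T -> nat -> bool).
Hypothesis sys : cluster_system s m chi side.

Local Open Scope ring_scope.
Variables (F : realFieldType) (e : F).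
Hypotheses (s_gt0 : (0 < s)%N) (e_gt0 : 0 < e).
Hypothesis e_small : 64%:R * 200%:R * s%:R ^+ 2 * e <= 1.

Local Notation cl := (cluster chi).
Local Notation hf := (half chi side).
Local Notation G := (edge_weight s chi side F).

Definition fiber (w : T -> L) l : {set T} := [set x | w x == l].

(** Regularity of the pairs in [rho], cleared of denominators: two large pieces [S], [S'] of one
    part have nearly equal densities to [R]. The one-sided form suffices because [S] and [S'] can be
    exchanged. *)
Definition regular_pairs (z w : T -> L) (rho : L -> L -> bool) : Prop :=
  forall l l' (S S' R : {set T}), rho l l' ->
    S \subset fiber z l -> S' \subset fiber z l -> R \subset fiber w l' ->
    e * #|fiber z l|%:R <= #|S|%:R -> e * #|fiber z l|%:R <= #|S'|%:R ->
    e * #|fiber w l'|%:R <= #|R|%:R ->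
    \sum_(y in R) ((\sum_(x in S) G x y) * #|S'|%:R -
                   (\sum_(x in S') G x y) * #|S|%:R)
      <= e * (#|S|%:R * #|S'|%:R * #|R|%:R).

(** The proportion of a part allowed outside its main cluster; a part may lose [kappa / s] at each
    of the [s] levels. *)
Definition kappa : F := (200%:R * s%:R)^-1.

Definition concentrated (w : T -> L) r l : bool :=
  [exists i : 'I_(m r),
     (1 - kappa) * #|fiber w l|%:R <= #|fiber w l :&: cl r i|%:R].

Definition stray (w : T -> L) r : {set T} :=
  [set x | ~~ concentrated w r (w x)].

Lemma sum_fibers (w : T -> L) (f : T -> F) :
  \sum_x f x = \sum_l \sum_(x in fiber w l) f x.
Proof.
rewrite (partition_big w predT) //=; apply: eq_bigr => l _.
by apply: eq_bigl => x; rewrite inE.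
Qed.

Let s_ge1 : 1 <= s%:R :> F. Proof. by rewrite ler1n. Qed.

Lemma kappa_gt0 : 0 < kappa.
Proof. by rewrite invr_gt0 mulr_gt0 ?ltr0n. Qed.

Lemma kappaE : 200%:R * s%:R * kappa = 1.
Proof. by rewrite divff // mulf_neq0 ?pnatr_eq0 // -lt0n. Qed.

Lemma kappa_le : kappa <= 200%:R^-1.
Proof.
have := kappaE; have := kappa_gt0 => k0 k1.
have : 200%:R * kappa * 1 <= 200%:R * kappa * s%:R by rewrite ler_pM2l // mulr_gt0.
by lra.
Qed.

Lemma e_le_kappa : 64%:R * s%:R * e <= kappa.
Proof.
have : (64%:R * s%:R * e) * (200%:R * s%:R) <= kappa * (200%:R * s%:R).
  by move: kappaE e_small; move: (s%:R : F) => s'; lra.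
by rewrite ler_pM2r // mulr_gt0 ?ltr0n.
Qed.

Lemma e_le_kappa1 : 64%:R * e <= kappa.
Proof.
apply: le_trans e_le_kappa; rewrite -mulrA ler_pM2l //.
by rewrite ler_peMl // ltW.
Qed.

(** A concentrated part has at most a proportion [kappa] outside its main cluster. The counted
    vertices inside that cluster all lie in one half, whose overlap with the part is below a
    proportion [e] as soon as one such vertex exists. The other parts are paid for by [stray]. *)
Lemma card_small_overlap (w : T -> L) r i :
  (#|[set y in hf r (chi r y) i |
      #|hf r (chi r y) i :&: fiber w (w y)|%:R < e * #|fiber w (w y)|%:R]|)%:R
    <= (kappa + e) * #|T|%:R + #|stray w r|%:R.
Proof.
set B := [set y in _ | _].
have -> : #|B|%:R = \sum_y (y \in B)%:R :> F.
  by rewrite -natr_sum -sum1_card [in RHS](big_mkcond) /= big_mkcond.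
have -> : #|stray w r|%:R = \sum_y (y \in stray w r)%:R :> F.
  by rewrite -natr_sum -sum1_card big_mkcond.
have -> : (kappa + e) * #|T|%:R = \sum_(y : T) (kappa + e).
  by rewrite sumr_const mulr_natr.
rewrite -big_split /= (sum_fibers w) [X in _ <= X](sum_fibers w).
apply: ler_sum => l _.
have k0 := kappa_gt0; have e0 := e_gt0.
case: (boolP (concentrated w r l)) => [/existsP[j0 Hj0]|nc]; last first.
  apply: ler_sum => y; rewrite [y \in stray w r]inE inE => /eqP ->.
  have : (y \in B)%:R <= 1 :> F by rewrite lern1 leq_b1.
  by rewrite nc mulr1n; lra.
apply: le_trans (_ : \sum_(y in fiber w l) (kappa + e) <= _); last first.
  by apply: ler_sum => y _; rewrite lerDl ler0n.
rewrite sumr_const -mulr_natr mulrDl.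
have -> : \sum_(y in fiber w l) (y \in B)%:R = #|fiber w l :&: B|%:R :> F.
  rewrite -natr_sum -sum1_card big_mkcond [in RHS]big_mkcond /=.
  by congr (_%:R); apply: eq_bigr => y _; rewrite in_setI; case: (_ \in fiber _ _).
rewrite -(cardsID (cl r j0)) natrD addrC; apply: lerD.
  apply: le_trans (_ : #|fiber w l :\: cl r j0|%:R <= _).
    rewrite ler_nat subset_leq_card //; apply/subsetP => y.
    by rewrite !inE => /and3P[-> ->].
  by have := cardsID (cl r j0) (fiber w l) => /(congr1 (fun n => n%:R : F));
    rewrite natrD; lra.
set A := fiber w l :&: B :&: cl r j0.
have [->|[y0 y0A]] := set_0Vmem A; first by rewrite cards0 mulr_ge0 // ltW.
apply/ltW; move: (y0A); rewrite !inE => /andP[/and3P[/eqP <- _ lt] /eqP cy].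
apply: le_lt_trans lt; rewrite ler_nat subset_leq_card //.
apply/subsetP => y; move: y0A; rewrite !inE.
move=> /andP[/andP[/eqP -> _] _] /andP[/and3P[/eqP -> /andP[_ sy] _] /eqP yj].
by rewrite yj cy sy !eqxx.
Qed.

(** * Parts spread over several children are irregular with many others *)

Section IrregularMass.

Variables (z w : T -> L) (rho : L -> L -> bool) (l : L) (r i : nat).
Hypothesis rho_reg : regular_pairs z w rho.
Hypotheses (rs : (r < s)%N) (im : (i < m r)%N).
Hypothesis stray_small : #|stray w r|%:R <= kappa * #|T|%:R.
Hypothesis fiber_gt0 : (0 < #|fiber z l|)%N.
Hypothesis splits : forall k,
  #|fiber z l :&: cl r i :&: cl r.+1 k|%:R + kappa / s%:R * #|fiber z l|%:R
    <= #|fiber z l :&: cl r i|%:R.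

Let Z0 := fiber z l :&: cl r i.
Let t := kappa / s%:R * #|fiber z l|%:R.
Let bad y : F := (~~ rho l (w y))%:R.
Let small j y : F :=
  (#|hf r j i :&: fiber w (w y)|%:R < e * #|fiber w (w y)|%:R)%R%:R.

(** The two pieces of [Z0] have densities to [hf r j i] differing by exactly [1/s]. A vertex of the
    half whose part is regular with [l] and overlaps the half enough accounts for [e] of this
    difference, any other vertex for at most 1. *)
Lemma balanced_split_bound j : (j < m r)%N ->
  t <= 32%:R * #|[set x in Z0 | side r x j]|%:R ->
  t <= 32%:R * #|[set x in Z0 | ~~ side r x j]|%:R ->
  #|hf r j i|%:R / s%:R <= \sum_(y in hf r j i) (e + bad y + small j y).
Proof.
move=> jm; set S := [set x in Z0 | _]; set S' := [set x in Z0 | _] => tS tS'.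
have e0 := e_gt0; have s1 := s_ge1.
have k0 := kappa_gt0; have k1 := kappaE; have ek := e_le_kappa.
have Zp : 0 < #|fiber z l|%:R :> F by rewrite ltr0n.
(* A piece of size [t/32] is thus large enough for regularity to apply. *)
have te : 32%:R * (e * #|fiber z l|%:R) <= t.
  rewrite /t mulrA ler_pM2r // ler_pdivlMr ?ltr0n //.
  have : 0 <= s%:R * e by rewrite mulr_ge0 // ltW.
  lra.
have eS : e * #|fiber z l|%:R <= #|S|%:R by lra.
have eS' : e * #|fiber z l|%:R <= #|S'|%:R by lra.
have Sp : 0 < #|S|%:R :> F by apply: lt_le_trans eS; rewrite mulr_gt0.
have S'p : 0 < #|S'|%:R :> F by apply: lt_le_trans eS'; rewrite mulr_gt0.
have SS'p : 0 < #|S|%:R * #|S'|%:R :> F by rewrite mulr_gt0.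
pose D y : F := (\sum_(x in S) G x y) * #|S'|%:R -
                   (\sum_(x in S') G x y) * #|S|%:R.
rewrite -(ler_pM2l SS'p).
have -> : #|S|%:R * #|S'|%:R * (#|hf r j i|%:R / s%:R) =
          \sum_(y in hf r j i) D y.
  have -> : \sum_(y in hf r j i) D y =
    \sum_(x in S) \sum_(x' in S') \sum_(y in hf r j i) (G x y - G x' y).
    under [RHS]eq_bigr => x _ do rewrite exchange_big /=.
    rewrite [RHS]exchange_big /=; apply: eq_bigr => y _.
    under [RHS]eq_bigr => x _ do rewrite sumrB sumr_const.
    by rewrite sumrB sumr_const sumrMnl /D !mulr_natr.
  under eq_bigr => x xS.
    under eq_bigr => x' x'S.
      rewrite (edge_weight_half sys F (i := i) rs jm); first over.
      - by move: xS; rewrite !inE => /andP[/andP[_ /eqP ->]].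
      - by move: x'S; rewrite !inE => /andP[/andP[_ /eqP ->]].
      - by move: xS; rewrite !inE => /andP[].
      - by move: x'S; rewrite !inE => /andP[].
    rewrite sumr_const; over.
  by rewrite sumr_const -mulrA (mulr_natl _ #|S|) (mulr_natl _ #|S'|).
have Dle y : D y <= #|S|%:R * #|S'|%:R.
  have : \sum_(x in S) G x y <= #|S|%:R.
    rewrite -sumr_const; apply: ler_sum => x _.
    by case/andP: (edge_weight01 s chi side F x y).
  have : 0 <= \sum_(x in S') G x y.
    apply: sumr_ge0 => x _.
    by case/andP: (edge_weight01 s chi side F x y).
  rewrite /D => h1 h2.
  have := ler_wpM2r (ltW S'p) h2; have := mulr_ge0 h1 (ltW Sp); lra.
rewrite mulr_sumr.
rewrite (partition_big w predT) //= [X in _ <= X](partition_big w predT) //=.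
apply: ler_sum => l' _.
pose R := hf r j i :&: fiber w l'.
have RE (f : T -> F) : \sum_(y in hf r j i | w y == l') f y = \sum_(y in R) f y.
  by apply: eq_bigl => y; rewrite !inE.
rewrite !RE.
have [rl|nrl] := boolP (rho l l'); last first.
  apply: ler_sum => y /setIP[_]; rewrite inE => /eqP Ey.
  apply: le_trans (Dle y) _; rewrite ler_peMr ?(ltW SS'p) //.
  by rewrite /bad Ey nrl addrAC lerDr addr_ge0 ?ler0n // ltW.
have [sm|] := ltP #|R|%:R (e * #|fiber w l'|%:R).
  apply: ler_sum => y /setIP[_]; rewrite inE => /eqP Ey.
  apply: le_trans (Dle y) _; rewrite ler_peMr ?(ltW SS'p) //.
  by rewrite /small Ey sm lerDr addr_ge0 ?ler0n // ltW.
move=> big.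
apply: le_trans (_ : e * (#|S|%:R * #|S'|%:R * #|R|%:R) <= _).
  apply: rho_reg rl _ _ _ eS eS' big.
  - by apply/subsetP => x; rewrite !inE => /andP[/andP[]].
  - by apply/subsetP => x; rewrite !inE => /andP[/andP[]].
  - exact: subsetIr.
rewrite -mulr_sumr mulrCA ler_pM2l // -[X in _ * X]sumr_const mulr_sumr.
apply: ler_sum => y _; rewrite mulr1 -addrA lerDl.
by rewrite addr_ge0 ?ler0n.
Qed.

(** [balanced_split_bound] is summed over the balanced [j], at least [m r / 16] in number, each half
    having size [|T| / (2 m r)]. The left side is at least [|T| / (32 s)], while the terms other
    than the irregular mass total at most [(2 kappa + 2 e) |T|], which is less than half of that. *)
Lemma irregular_mass :
  #|T|%:R <= 64%:R * s%:R * #|[set y | ~~ rho l (w y)]|%:R :> F.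
Proof.
have e0 := e_gt0; have s1 := s_ge1.
have k0 := kappa_gt0; have k1 := kappaE; have ek := e_le_kappa1.
have Zp : 0 < #|fiber z l|%:R :> F by rewrite ltr0n.
have sp : 0 < s%:R :> F by rewrite ltr0n.
have tp : 0 < t by rewrite !mulr_gt0 // invr_gt0.
have := many_balanced_splits sys rs tp (subsetIr _ _ : Z0 \subset _) splits.
set J := [set j : 'I_(m r) | _] => HJ.
have mp : 0 < (m r)%:R :> F by rewrite ltr0n; apply: leq_ltn_trans im.
(* The halves for different [j] are disjoint, so each [y] is charged only for [j = chi r y]. *)
have sumJ : \sum_(j in J) #|hf r j i|%:R / s%:R <=
            \sum_y (e + bad y + (y \in hf r (chi r y) i)%:R * small (chi r y) y).
  pose p y := Ordinal (chi_lt sys y (ltnW rs)).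
  rewrite [X in _ <= X](partition_big p predT) //= big_mkcond /=.
  apply: ler_sum => j _; case: ifP => [|_]; last first.
    by apply: sumr_ge0 => y _; rewrite !addr_ge0 ?mulr_ge0 ?ler0n // ltW.
  rewrite inE => /andP[t1 t2].
  apply: le_trans (balanced_split_bound (ltn_ord j) t1 t2) _.
  rewrite [X in _ <= X](bigID [in hf r j i]) /= ler_wpDr //.
    by apply: sumr_ge0 => y _; rewrite !addr_ge0 ?mulr_ge0 ?ler0n // ltW.
  rewrite le_eqVlt; apply/orP; left; apply/eqP.
  apply: eq_big => [y|y yh].
    rewrite andbC; case: (boolP (y \in hf r j i)) => //=.
    by rewrite !inE => /andP[/eqP yj _]; symmetry; apply/eqP/val_inj.
  have -> : chi r y = j by move: yh; rewrite !inE => /andP[/eqP ->].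
  by rewrite yh mul1r.
have hfE (j : 'I_(m r)) : #|hf r j i|%:R = #|T|%:R / (2%:R * (m r)%:R) :> F.
  rewrite -(card_cluster sys (ltnW rs) (ltn_ord j)).
  rewrite -(card_half sys rs (ltn_ord j) im) !natrM.
  by field; rewrite gt_eqF.
move: sumJ; under eq_bigr => j _ do rewrite hfE.
rewrite sumr_const !big_split /= -(mulr_natl _ #|J|).
have -> : \sum_(y : T) e = e * #|T|%:R by rewrite sumr_const mulr_natr.
have -> : \sum_y bad y = #|[set y | ~~ rho l (w y)]|%:R.
  by rewrite -natr_sum -sum1dep_card [in RHS]big_mkcond.
have -> : \sum_y (y \in hf r (chi r y) i)%:R * small (chi r y) y =
  (#|[set y in hf r (chi r y) i |
      #|hf r (chi r y) i :&: fiber w (w y)|%:R < e * #|fiber w (w y)|%:R]|)%:R.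
  rewrite -sum1dep_card [in RHS]big_mkcond natr_sum /=; apply: eq_bigr => y _.
  by rewrite -natrM mulnb; case: (_ && _).
have := card_small_overlap w r i.
set a := (X in X <= _); set b := #|[set y | ~~ _]|%:R => ab.
have J1 : #|T|%:R / 32%:R / s%:R <= #|J|%:R * (#|T|%:R / (2%:R * (m r)%:R) / s%:R) :> F.
  rewrite [X in _ <= X]mulrA ler_pM2r ?invr_gt0 //.
  rewrite mulrA ler_pdivlMr ?mulr_gt0 //.
  have := ler_wpM2l (ler0n F #|T|) HJ; lra.
move=> J2; have := le_trans J1 J2 => {J1 J2}.
have ks : kappa = s%:R^-1 / 200%:R by rewrite /kappa invfM mulrC.
have : 64%:R * e * #|T|%:R <= kappa * #|T|%:R by rewrite ler_wpM2r.
have Np := ler0n F #|T|; have st := stray_small.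
move=> h1 h2.
have h3 : #|T|%:R / s%:R <= 64%:R * b.
  have : #|T|%:R / s%:R = kappa * #|T|%:R * 200%:R by rewrite ks; field; lra.
  have : 0 <= b by exact: ler0n.
  lra.
by move: h3; rewrite ler_pdivrMr // => h3; lra.
Qed.

End IrregularMass.

(** Descent through the levels: either some step loses at least [kappa / s] of the part whichever
    child is chosen, or a child keeping all but that much can be followed at every level. *)
Lemma fiber_splits (z : T -> L) x r : m 0 = 1%N -> (r <= s)%N ->
  (exists2 r', (r' < r)%N & exists2 i, (i < m r')%N &
     forall k, #|fiber z (z x) :&: cl r' i :&: cl r'.+1 k|%:R +
       kappa / s%:R * #|fiber z (z x)|%:R <= #|fiber z (z x) :&: cl r' i|%:R)
  \/ (exists2 i, (i < m r)%N &
      (1 - r%:R * (kappa / s%:R)) * #|fiber z (z x)|%:R <=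
      #|fiber z (z x) :&: cl r i|%:R).
Proof.
move=> m0; elim: r => [|r IH] rs.
  right; exists 0%N; rewrite ?m0 // mul0r subr0 mul1r ler_nat.
  apply/subset_leq_card/subsetP => y; rewrite !inE => -> /=.
  by have := chi_lt sys y (leq0n s); rewrite m0; case: (chi 0 y).
case: (IH (ltnW rs)) => [[r' r'r H]|[i im Hi]]; first by left; exists r' => //; exact: ltnW.
set Z := fiber z (z x) in Hi *.
case: (classic (forall k, #|Z :&: cl r i :&: cl r.+1 k|%:R +
       kappa / s%:R * #|Z|%:R <= #|Z :&: cl r i|%:R)) => [H|].
  by left; exists r => //; exists i.
case/not_all_ex_not => k /negP; rewrite -ltNge => lt; right; exists k.
  have [s1 k0] := (s_ge1, kappa_gt0).
  have rk : r.+1%:R * (kappa / s%:R) <= kappa.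
    by rewrite mulrA ler_pdivrMr ?ltr0n // mulrC ler_pM2l // ler_nat.
  (* Here [k] is an arbitrary natural number; a nonempty intersection makes it a genuine cluster
     index. *)
  have : 0 < #|Z :&: cl r i :&: cl r.+1 k|%:R :> F.
    have Z0 := ler0n F #|Z|; have := kappa_le => k1.
    have h : r.+1%:R * (kappa / s%:R) * #|Z|%:R <= 1 * #|Z|%:R.
      by rewrite ler_wpM2r //; lra.
    move: lt Hi h; rewrite -natr1; lra.
  rewrite ltr0n card_gt0 => /set0Pn[y]; rewrite !inE => /andP[_ /eqP <-].
  exact: (chi_lt sys).
have : #|Z :&: cl r i :&: cl r.+1 k|%:R <= #|Z :&: cl r.+1 k|%:R :> F.
  rewrite ler_nat subset_leq_card //.
  by apply/subsetP => y; rewrite !inE => /andP[/andP[-> _] ->].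
by move: lt Hi; rewrite -natr1; lra.
Qed.

(** Every stray vertex lies in a part irregular with a mass of at least [|T| / (64 s)] on the other
    side. There are at most [e |T|^2] irregular pairs and [64 s e <= kappa]. *)
Lemma stray_step (z w : T -> L) rho r : m 0 = 1%N -> (r < s)%N ->
  regular_pairs z w rho ->
  #|[set p : T * T | ~~ rho (z p.1) (w p.2)]|%:R <= e * #|T|%:R ^+ 2 ->
  (forall r', (r' <= r)%N -> #|stray w r'|%:R <= kappa * #|T|%:R) ->
  #|stray z r.+1|%:R <= kappa * #|T|%:R.
Proof.
move=> m0 rs zw irr w_ok.
have [[k0 s1] ek] := (kappa_gt0, s_ge1, e_le_kappa).
have mass x : x \in stray z r.+1 ->
   #|T|%:R <= 64%:R * s%:R * #|[set y | ~~ rho (z x) (w y)]|%:R :> F.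
  rewrite inE => nc.
  have Zp : (0 < #|fiber z (z x)|)%N by apply/card_gt0P; exists x; rewrite inE.
  case: (fiber_splits z x m0 rs) => [[r' r'r [i im H]]|[i im Hi]].
    apply: (irregular_mass zw (leq_trans r'r rs) im (w_ok _ _) Zp H).
    by rewrite -ltnS.
  case/negP: nc; apply/existsP; exists (Ordinal im) => /=.
  apply: le_trans Hi; rewrite ler_pM2r ?ltr0n // lerD2l lerN2.
  by rewrite mulrA ler_pdivrMr ?ltr0n // mulrC ler_pM2l // ler_nat.
have [N0|Np] := posnP #|T|.
  have -> : stray z r.+1 = set0.
    by apply/setP => x; have := fintype0 x N0.
  by rewrite cards0 mulr_ge0 // ltW.
have Np' : 0 < #|T|%:R :> F by rewrite ltr0n.
rewrite -(ler_pM2r Np').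
apply: le_trans (_ : 64%:R * s%:R * (e * #|T|%:R ^+ 2) <= _); last first.
  rewrite expr2 !mulrA ler_pM2r // ler_pM2r //.
apply: le_trans (_ : 64%:R * s%:R *
   #|[set p : T * T | ~~ rho (z p.1) (w p.2)]|%:R <= _); last first.
  by rewrite ler_pM2l // mulr_gt0 // ltr0n.
have -> : #|[set p : T * T | ~~ rho (z p.1) (w p.2)]|%:R =
   \sum_x #|[set y | ~~ rho (z x) (w y)]|%:R :> F.
  rewrite -natr_sum -sum1dep_card big_mkcond.
  rewrite -(pair_bigA _ (fun x y => if ~~ rho (z x) (w y) then 1 else 0)%N) /=.
  by congr (_%:R); apply: eq_bigr => x _; rewrite -big_mkcond sum1dep_card.
rewrite (mulr_natl _ #|stray z r.+1|) -sumr_const mulr_sumr big_mkcond /=.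
apply: ler_sum => x _; case: ifP => [/mass //|_].
by rewrite !mulr_ge0 // ler0n.
Qed.

(** The induction treats both sides together: level [r + 1] on one side needs all levels up to [r]
    on the other. *)
Theorem stray_bound (z w : T -> L) rho : m 0 = 1%N ->
  regular_pairs z w rho -> regular_pairs w z (fun l l' => rho l' l) ->
  #|[set p : T * T | ~~ rho (z p.1) (w p.2)]|%:R <= e * #|T|%:R ^+ 2 ->
  forall r, (r <= s)%N ->
  #|stray z r|%:R <= kappa * #|T|%:R /\ #|stray w r|%:R <= kappa * #|T|%:R.
Proof.
move=> m0 zw wz irr r.
have irr' : #|[set p : T * T | ~~ rho (z p.2) (w p.1)]|%:R <= e * #|T|%:R ^+ 2.
  apply: le_trans irr; rewrite ler_nat.
  have sw : injective (fun p : T * T => (p.2, p.1)).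
    by move=> [? ?] [? ?] [-> ->].
  rewrite -(card_imset _ sw) subset_leq_card //.
  by apply/subsetP => _ /imsetP[[x y] + ->]; rewrite !inE.
have base v : #|stray v 0|%:R <= kappa * #|T|%:R.
  have -> : stray v 0 = set0.
    apply/setP => x; rewrite !inE; apply/negbTE; rewrite negbK.
    have [[r'] //|[i im H]] := fiber_splits v x m0 (leq0n s).
    apply/existsP; exists (Ordinal im); apply: le_trans H.
    by rewrite mul0r subr0 ler_wpM2r // gerBl ltW ?kappa_gt0.
  by rewrite cards0 mulr_ge0 // ltW ?kappa_gt0.
elim/ltn_ind: r => -[|r] IH rs; first by split.
split.
  by apply: (stray_step m0 rs zw irr) => r' r'r; case: (IH r' r'r (leq_trans r'r (ltnW rs))).
by apply: (stray_step m0 rs wz irr') => r' r'r; case: (IH r' r'r (leq_trans r'r (ltnW rs))).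
Qed.

(** A part concentrated at level [s] has size at most [|T| / ((1 - kappa) m s)], and such parts
    cover a proportion [1 - kappa] of [T]; finally [(1 - kappa)^2 >= 1/4]. *)
Theorem many_labels (z w : T -> L) rho : m 0 = 1%N -> (0 < #|T|)%N ->
  regular_pairs z w rho -> regular_pairs w z (fun l l' => rho l' l) ->
  #|[set p : T * T | ~~ rho (z p.1) (w p.2)]|%:R <= e * #|T|%:R ^+ 2 ->
  (m s <= 4 * #|[set z x | x in T]|)%N.
Proof.
move=> m0 Tp zw wz irr.
have [st _] := stray_bound m0 zw wz irr (leqnn s).
have [k0 k1] := (kappa_gt0, kappa_le).
have Np : 0 < #|T|%:R :> F by rewrite ltr0n.
have mp : (0 < m s)%N.
  case/card_gt0P: Tp => x _; exact: leq_ltn_trans (chi_lt sys x (leqnn s)).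
rewrite -(ler_nat F) natrM -(ler_pM2r Np).
have fib l : concentrated z s l ->
    (1 - kappa) * (#|fiber z l|%:R * (m s)%:R) <= #|T|%:R.
  case/existsP=> i Hi; rewrite mulrA.
  apply: le_trans (ler_wpM2r (ler0n _ _) Hi) _.
  rewrite -natrM ler_nat -(card_cluster sys (leqnn s) (ltn_ord i)).
  by rewrite leq_mul2r subset_leq_card ?orbT // subsetIr.
have : (1 - kappa) * #|T|%:R <= #|~: stray z s|%:R.
  have := cardsC (stray z s) => /(congr1 (fun n => n%:R : F)).
  by rewrite natrD; lra.
have -> : #|~: stray z s|%:R =
    \sum_(l in [set z x | x in T]) \sum_(x in fiber z l) (x \notin stray z s)%:R :> F.
  rewrite -sum1_card natr_sum big_mkcond /=.
  rewrite (partition_big z [in [set z x | x in T]]) => [|x _] /=; last first.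
    exact: imset_f.
  apply: eq_bigr => l _; apply: eq_big => x; rewrite !inE //.
  by case: (concentrated _ _ _).
move=> h1.
have h2 : (1 - kappa) * (m s)%:R * \sum_(l in [set z x | x in T])
     \sum_(x in fiber z l) (x \notin stray z s)%:R <=
   #|[set z x | x in T]|%:R * #|T|%:R :> F.
  rewrite mulr_sumr mulr_natl -sumr_const; apply: ler_sum => l _.
  case: (boolP (concentrated z s l)) => [/fib|nc].
    apply: le_trans; rewrite -mulrA ler_pM2l; last by lra.
    rewrite mulrC ler_wpM2r // -sumr_const.
    by apply: ler_sum => x _; rewrite lern1 leq_b1.
  rewrite big1 ?mulr0 ?(ltW Np) // => x; rewrite !inE negbK => /eqP ->.
  by rewrite (negbTE nc).
set S := \sum_(l in _) _ in h1 h2.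
have mp' : 0 < (m s)%:R :> F by rewrite ltr0n.
have h3 : (1 - kappa) * (m s)%:R * ((1 - kappa) * #|T|%:R) <=
          #|[set z x | x in T]|%:R * #|T|%:R.
  apply: le_trans h2; rewrite ler_wpM2l // mulr_ge0 ?ler0n //; lra.
have h4 : 4%:R * (1 - kappa) ^+ 2 >= 1 by nra.
have h5 : (m s)%:R * #|T|%:R * 1 <= (m s)%:R * #|T|%:R * (4%:R * (1 - kappa) ^+ 2) :> F.
  by rewrite ler_pM2l // mulr_gt0.
by rewrite -mulrA; lra.
Qed.

End Concentration.

(** * Codes and the concrete equipartitions *)

Section Codes.

Variable m : nat.
Local Notation word := {ffun 'I_m -> bool}.

Definition hdist (u v : word) : nat := #|[set j | u j != v j]|.

Definition compl_word (u : word) : word := [ffun j => ~~ u j].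

(** Distance from the complement is required as well, so that adjoining all complements preserves
    the minimum distance. *)
Definition far (u v : word) : bool :=
  (m <= 8 * hdist u v) && (m <= 8 * hdist u (compl_word v)).

Definition is_code (C : {set word}) : bool :=
  [forall u in C, forall v in C, (u != v) ==> far u v].

Definition best_code : {set word} := [arg max_(C > set0 | is_code C) #|C|].

Lemma hdistC u v : hdist u v = hdist v u.
Proof. by apply: eq_card => j; rewrite !inE eq_sym. Qed.

Lemma hdist_compl u v : hdist (compl_word u) v = hdist u (compl_word v).
Proof. by apply: eq_card => j; rewrite !inE !ffunE; case: (u j) (v j) => [] []. Qed.

Lemma far_sym u v : far u v = far v u.
Proof. by rewrite /far hdistC [hdist u (compl_word v)]hdistC hdist_compl. Qed.

Lemma best_codeP :
  is_code best_code /\ forall C, is_code C -> #|C| <= #|best_code|.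
Proof.
rewrite /best_code; case: arg_maxnP => [|C HC Hmax]; last by split.
by apply/forall_inP => u; rewrite inE.
Qed.

Lemma best_code_far u v : u \in best_code -> v \in best_code -> u != v -> far u v.
Proof.
have [/forall_inP H _] := best_codeP.
by move=> uC vC uv; move/forall_inP: (H u uC) => /(_ v vC) /implyP; apply.
Qed.

(** Otherwise [v] could be added to the code. For [v] in the code [u = v] works, its distance 0
    being less than [m / 8]. *)
Lemma best_code_maximal v : 0 < m -> exists2 u, u \in best_code & ~~ far u v.
Proof.
move=> m0; case: (boolP (v \in best_code)) => [vC|vC].
  exists v => //; rewrite /far /hdist.
  rewrite (_ : [set j | v j != v j] = set0) ?cards0 ?muln0 -?ltnNge ?m0 //.
    by rewrite leqNgt m0.
  by apply/setP => j; rewrite !inE eqxx.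
have [/forall_inP H Hmax] := best_codeP.
have [|] := boolP [exists u in best_code, ~~ far u v].
  by case/exists_inP => u; exists u.
rewrite negb_exists_in => /forall_inP Hv.
suff /Hmax : is_code (v |: best_code) by rewrite cardsU1 vC ltnn.
have Hv' u : u \in best_code -> far u v by move/Hv; rewrite negbK.
apply/forall_inP => a /setU1P[->|aC]; apply/forall_inP => b /setU1P[->|bC];
  apply/implyP => // ab.
- by rewrite eqxx in ab.
- by rewrite far_sym Hv'.
- exact: Hv'.
- exact: best_code_far.
Qed.

(** Each coordinate contributes a factor 2 on agreement and 1 on disagreement, and the sum of
    products factors. *)
Lemma sum_expn_hdist u : \sum_v 2 ^ (m - hdist u v) = 3 ^ m.
Proof.
transitivity (\sum_(v : word) \prod_j (if u j == v j then 2 else 1)).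
  apply: eq_bigr => v _; rewrite -big_mkcond prod_nat_const; congr (2 ^ _).
  have := cardsC [set j | u j != v j]; rewrite card_ord => E.
  have -> : m - hdist u v = #|~: [set j | u j != v j]| by rewrite -[X in X - _]E addKn.
  by apply: eq_card => j; rewrite !inE negbK.
rewrite -(bigA_distr_bigA (fun j b => if u j == b then 2 else 1)).
rewrite -[in RHS](card_ord m) -prod_nat_const; apply: eq_bigr => j _.
by rewrite big_bool; case: (u j).
Qed.

(** An exponential moment bound: each word of the ball has weight at least [2 ^ (m - m %/ 8)] in the
    sum of total [3 ^ m]. *)
Lemma card_ball u : #|[set v | ~~ (m <= 8 * hdist u v)]| * 2 ^ (m - m %/ 8) <= 3 ^ m.
Proof.
rewrite -(sum_expn_hdist u) -sum_nat_const big_mkcond.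
apply: leq_sum => v _; rewrite inE -ltnNge; case: ifP => // lt.
by rewrite leq_pexp2l // leq_sub2l // leq_divRL // mulnC ltnW.
Qed.

(** A Gilbert-Varshamov argument: by maximality the balls around the codewords and their complements
    cover all words. *)
Lemma card_best_code : 0 < m ->
  2 ^ m * 2 ^ (m - m %/ 8) <= 2 * #|best_code| * 3 ^ m.
Proof.
move=> m0.
have -> : 2 ^ m = #|[set: word]| by rewrite cardsT card_ffun card_bool card_ord.
rewrite -sum_nat_const mulnAC mulnC -sum_nat_const.
pose B u := [set v : word | ~~ (m <= 8 * hdist u v)].
apply: leq_trans (_ : \sum_(u in best_code) (#|B u| + #|B (compl_word u)|) *
   2 ^ (m - m %/ 8) <= _); last first.
  apply: leq_sum => u _; rewrite mulnDl mul2n -addnn.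
  by apply: leq_add; apply: card_ball.
rewrite -big_distrl sum_nat_const leq_mul2r; apply/orP; right.
apply: leq_trans (_ : \sum_(v : word) \sum_(u in best_code)
   ((v \in B u) + (v \in B (compl_word u))) <= _).
  rewrite -sum1_card big_mkcond; apply: leq_sum => v _; rewrite inE.
  have [u uC nf] := best_code_maximal v m0.
  rewrite (bigD1 u) //=; apply: leq_trans (leq_addr _ _).
  by move: nf; rewrite /far negb_and -hdist_compl /B !inE => /orP[] ->; rewrite ?addn1.
rewrite exchange_big; apply: leq_sum => u _.
rewrite big_split; apply: leq_add.
  by rewrite -sum1_card [X in _ <= X]big_mkcond; apply: leq_sum => v _; case: (v \in _).
by rewrite -sum1_card [X in _ <= X]big_mkcond; apply: leq_sum => v _; case: (v \in _).
Qed.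

Definition code_size := 2 * #|best_code|.

(** Word [2 i] is the [i]-th codeword and word [2 i + 1] its complement, the parity of [k] flipping
    every bit. *)
Definition code_bit (k j : nat) : bool :=
  if insub j is Some i then nth [ffun=> false] (enum best_code) k./2 i (+) odd k
  else false.

Lemma card_best_code_gt0 : 0 < m -> 0 < #|best_code|.
Proof. by case/(best_code_maximal [ffun=> false]) => u uC _; apply/card_gt0P; exists u. Qed.

Lemma sum_code_bit j : j < m -> 2 * (\sum_(k < code_size) code_bit k j) = code_size.
Proof.
move=> jm; congr (2 * _); rewrite /code_size mul2n.
under eq_bigr => k _ do rewrite /code_bit insubT.
elim: #|best_code| => [|n IH]; first by rewrite big_ord0.
rewrite doubleS !big_ord_recr /= IH uphalf_double doubleK odd_double /=.
by rewrite addbF; case: (fun_of_fin _ _) => /=; rewrite ?addn0 ?addn1.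
Qed.

(** Two words from one codeword are complementary and differ everywhere. Words from two codewords
    are separated by the first or the second half of [far], according to whether the parities
    agree. *)
Lemma code_bit_separates k k' : k < code_size -> k' < code_size -> k <> k' ->
  m <= 8 * #|[set j : 'I_m | code_bit k j != code_bit k' j]|.
Proof.
rewrite /code_size mul2n => kC k'C kk'.
have kC' : k./2 < size (enum best_code) by rewrite -cardE -ltn_double; lia.
have k'C' : k'./2 < size (enum best_code) by rewrite -cardE -ltn_double; lia.
pose w k := nth [ffun=> false] (enum best_code) k./2.
rewrite (_ : [set j : 'I_m | _] =
   [set j : 'I_m | (w k j (+) odd k) != (w k' j (+) odd k')]); last first.
  apply/setP => j; rewrite !inE /code_bit.
  by case: insubP => [i _ /val_inj ->|]; rewrite ?ltn_ord.
have [E|ne] := eqVneq k./2 k'./2.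
  have od : odd k != odd k' by apply/eqP => o; apply: kk'; lia.
  rewrite (_ : [set j : 'I_m | _] = [set: 'I_m]) ?cardsT ?card_ord ?leq_pmull //.
  apply/setP => j; rewrite !inE /w E.
  by case: (fun_of_fin _ _) (odd k) (odd k') od => [] [] [].
have wk : w k \in best_code by rewrite -mem_enum mem_nth.
have wk' : w k' \in best_code by rewrite -mem_enum mem_nth.
have ww : w k != w k' by rewrite nth_uniq // enum_uniq.
case/andP: (best_code_far wk wk' ww) => far1 far2.
case: (eqVneq (odd k) (odd k')) => [->|od].
  apply: leq_trans far1 _; rewrite leq_mul2l /= subset_leq_card //.
  apply/subsetP => j; rewrite !inE.
  by case: (w k j) (w k' j) (odd k') => [] [] [].
apply: leq_trans far2 _; rewrite leq_mul2l /= subset_leq_card //.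
apply/subsetP => j; rewrite !inE !ffunE.
by case: (w k j) (w k' j) (odd k) (odd k') od => [] [] [] [].
Qed.

Lemma code_size_large : 0 < m -> 2 ^ (m %/ 4) <= 8 * code_size.
Proof.
move=> /card_best_code; rewrite -/code_size => H.
have p3 : 0 < 3 ^ m by rewrite expn_gt0.
rewrite -(leq_pmul2r p3) -mulnA.
apply: leq_trans (_ : 8 * (2 ^ m * 2 ^ (m - m %/ 8)) <= _); last by rewrite leq_mul2l.
have [q [t [-> t8]]] : exists q t, m = q * 8 + t /\ t < 8.
  by exists (m %/ 8), (m %% 8); rewrite -divn_eq ltn_mod.
have -> : (q * 8 + t) %/ 8 = q by rewrite divnMDl // divn_small // addn0.
have -> : (q * 8 + t) %/ 4 = 2 * q + t %/ 4 by lia.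
have -> : q * 8 + t - q = 7 * q + t by lia.
(* This is [3^8 = 6561 <= 8192 = 2^13]. *)
have A : 3 ^ (q * 8) <= 2 ^ (13 * q) by case: (q) => // q'; rewrite mulnC !expnM leq_exp2r.
have B : 3 ^ t <= 2 ^ (2 * t) by case: (t) => // t'; rewrite expnM leq_exp2r.
have C : 2 ^ (t %/ 4) <= 8 by apply: (@leq_pexp2l 2 _ 3) => //; lia.
rewrite (expnD 3) (expnD 2 (2 * q)).
apply: leq_trans (_ : 2 ^ (2 * q) * 8 * (2 ^ (13 * q) * 2 ^ (2 * t)) <= _).
  by apply: leq_mul; apply: leq_mul.
have -> : 2 ^ (2 * q) * 8 * (2 ^ (13 * q) * 2 ^ (2 * t)) =
          8 * 2 ^ (2 * q + 13 * q + 2 * t).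
  by rewrite (expnD 2 (2 * q + 13 * q)) (expnD 2 (2 * q)); ring.
by rewrite -expnD leq_mul2l leq_exp2l //=; lia.
Qed.

End Codes.

(** * A cluster system given by residues *)

Section ConcreteSystem.

Fixpoint level_size r :=
  if r is r'.+1 then level_size r' * code_size (level_size r') else 1.

Lemma level_size_gt0 r : 0 < level_size r.
Proof.
by elim: r => //= r IH; rewrite muln_gt0 IH muln_gt0 card_best_code_gt0.
Qed.

Lemma code_size_ge2 r : 2 <= code_size (level_size r).
Proof. by rewrite /code_size -[2]muln1 leq_mul2l card_best_code_gt0 ?level_size_gt0. Qed.

Lemma level_size_double r : 2 * level_size r <= level_size r.+1.
Proof. by rewrite mulnC leq_mul2l code_size_ge2 orbT. Qed.

(** Three levels gain one exponential. The first gives [2 ^ (level_size r %/ 4)], a size of at least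
    8 absorbing the factor 8 of [code_size_large]; the next two double it, restoring the factor
    4. *)
Lemma level_size_tower h : 8 <= level_size (3 + 3 * h) /\
  4 * Tw h <= level_size (3 + 3 * h).
Proof.
elim: h => [|h [IH8 IH]].
  suff : 8 <= level_size 3 by move=> H; split => //; apply: leq_trans H.
  by have := level_size_double 0; have := level_size_double 1;
    have := level_size_double 2; have : level_size 0 = 1 by []; lia.
have -> : 3 + 3 * h.+1 = (3 + 3 * h).+3 by lia.
set r := 3 + 3 * h in IH8 IH *.
have d1 := level_size_double r.+1; have d2 := level_size_double r.+2.
have d0 := level_size_double r.
split; first by lia.
have big : 2 ^ (level_size r %/ 4) <= level_size r.+1.
  apply: leq_trans (code_size_large (level_size_gt0 r)) _.
  by rewrite leq_mul2r IH8 orbT.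
have : Tw h.+1 <= 2 ^ (level_size r %/ 4).
  case: h @r IH8 IH big {d0 d1 d2} => [|h] r _ IH _; first by rewrite expn_gt0.
  change (2 ^ Tw h.+1 <= 2 ^ (level_size r %/ 4)).
  by rewrite leq_exp2l // leq_divRL // mulnC.
by lia.
Qed.

Lemma sum_div_mod q d (f : nat -> nat -> nat) :
  \sum_(a < q * d) f (a %/ d) (a %% d) = \sum_(k < q) \sum_(i < d) f k i.
Proof.
elim: q => [|q IH]; first by rewrite mul0n !big_ord0.
rewrite big_ord_recr /= -IH mulSn addnC big_split_ord /=; congr (_ + _).
apply: eq_bigr => i _; have d0 : 0 < d by apply: leq_ltn_trans (ltn_ord i).
by rewrite divnMDl // modnMDl divn_small // modn_small // addn0.
Qed.

Lemma sum_nat_eq n i : \sum_(j < n) (j == i :> nat) = (i < n).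
Proof.
case: (ltnP i n) => [lt|le].
  rewrite (bigD1 (Ordinal lt)) //= eqxx big1 // => j ne.
  by apply/eqP; rewrite eqb0; apply: contra ne => /eqP E; apply/eqP/val_inj.
by rewrite big1 // => j _; apply/eqP; rewrite eqb0; apply/eqP; have := ltn_ord j; lia.
Qed.

Variables (s : nat) (W : finType).

Local Notation T := ('I_(level_size s) * W)%type.

(** Residues nest because each level size divides the next; the factor [W] leaves room for the
    blow-up. *)
Definition level_cluster r (x : T) : nat := x.1 %% level_size r.

(** The residue at level [r + 1] is the cluster index plus [level_size r] times a quotient; the
    quotient numbers the child and hence its code word. *)
Definition level_side r (x : T) (j : nat) : bool :=
  code_bit (level_size r) (level_cluster r.+1 x %/ level_size r) j.

Lemma level_size_dvd r r' : r <= r' -> level_size r %| level_size r'.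
Proof.
elim: r' => [|r' IH]; first by rewrite leqn0 => /eqP ->.
by rewrite leq_eqVlt ltnS => /orP[/eqP -> //|/IH]; apply: dvdn_mulr.
Qed.

Lemma card_residues r (p : pred nat) : r <= s ->
  #|[set x : T | p (level_cluster r x)]| * level_size r =
  (\sum_(i < level_size r) p i) * #|{: T}|.
Proof.
move=> rs; rewrite card_prod card_ord.
have -> : #|[set x : T | p (level_cluster r x)]| =
          (\sum_(a < level_size s) p (a %% level_size r)) * #|W|.
  rewrite -sum1dep_card big_mkcond /=.
  rewrite -(pair_bigA _ (fun (a : 'I_(level_size s)) (_ : W) => if p (a %% level_size r) then 1 else 0)) /=.
  by rewrite big_distrl; apply: eq_bigr => a _; rewrite sum_nat_const mulnC; case: (p _).
have /dvdnP[q ->] := level_size_dvd rs.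
rewrite (sum_div_mod q (level_size r) (fun _ i => p i)) sum_nat_const card_ord.
by rewrite mulnAC; ring.
Qed.

Lemma level_cluster_system :
  cluster_system s level_size level_cluster level_side.
Proof.
have L := level_size_gt0.
have sub r x : r < s -> level_cluster r.+1 x %% level_size r = level_cluster r x.
  by move=> rs; rewrite /level_cluster modn_dvdm // dvdn_mulr.
have child r (x : T) : level_cluster r.+1 x %/ level_size r < code_size (level_size r).
  by rewrite ltn_divLR // mulnC /level_cluster ltn_mod L.
split.
- by move=> r x _; rewrite /level_cluster ltn_mod.
- move=> r i rs ir; rewrite (card_residues (pred1 i) rs) sum_nat_eq ir mul1n.
  by [].
- by move=> r x y rs E; rewrite -(sub r x rs) -(sub r y rs) E.
- by move=> r x y j rs E; rewrite /level_side E.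
- move=> r i j rs ir jr.
  have Q : 0 < code_size (level_size r) by apply: leq_trans (code_size_ge2 r).
  apply/eqP; rewrite -(eqn_pmul2r (L r.+1)) -mulnA; apply/eqP.
  pose p a := (a %% level_size r == i) && code_bit (level_size r) (a %/ level_size r) j.
  have -> : #|half level_cluster level_side r i j| = #|[set x : T | p (level_cluster r.+1 x)]|.
    by apply: eq_card => x; rewrite !inE /p sub.
  have -> : #|[set x : T | p (level_cluster r.+1 x)]| * level_size r.+1 =
            (\sum_(k < code_size (level_size r)) code_bit (level_size r) k j) * #|{: T}|.
    rewrite card_residues //=; congr (_ * _); rewrite mulnC.
    rewrite (sum_div_mod _ _ (fun k i' => (i' == i) && code_bit (level_size r) k j)).
    apply: eq_bigr => k _.
    case: (code_bit _ _ _); last by rewrite big1 // => i' _; rewrite andbF.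
    by under eq_bigr do rewrite andbT; rewrite sum_nat_eq ir.
  rewrite mulnA sum_code_bit //.
  have := card_residues (pred1 i) (ltnW rs); rewrite sum_nat_eq ir mul1n => <-.
  by rewrite /= -[X in _ = X * _]/(#|[set x : T | pred1 i (level_cluster r x)]|); ring.
- move=> r x y rs E ne; apply: code_bit_separates => // E'.
  by apply: ne; rewrite (divn_eq (level_cluster r.+1 x) (level_size r)) E'
    sub // E -(sub r y) // -divn_eq.
Qed.

End ConcreteSystem.

(** * Blow-up and embedding *)

Section BlowUp.

Local Open Scope ring_scope.
Variable F : realFieldType.

(** Cauchy-Schwarz, from the nonnegativity of the variance. *)
Lemma sqr_sum_le (I : finType) (A : {set I}) (f : I -> F) :
  (\sum_(i in A) f i) ^+ 2 <= #|A|%:R * \sum_(i in A) f i ^+ 2.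
Proof.
have [A0|Ap] := posnP #|A|.
  by rewrite (cards0_eq A0) !big_set0 expr0n mulr0.
have Ap' : 0 < #|A|%:R :> F by rewrite ltr0n.
set M := \sum_(i in A) f i; set Q := \sum_(i in A) _.
have : 0 <= \sum_(i in A) (#|A|%:R * f i - M) ^+ 2.
  by apply: sumr_ge0 => i _; exact: sqr_ge0.
under eq_bigr => i _ do rewrite sqrrB.
rewrite big_split sumrB /= sumr_const.
have -> : \sum_(i in A) (#|A|%:R * f i) ^+ 2 = #|A|%:R ^+ 2 * Q.
  by rewrite mulr_sumr; apply: eq_bigr => i _; rewrite exprMn.
have -> : \sum_(i in A) #|A|%:R * f i * M *+ 2 = #|A|%:R * M * M *+ 2.
  by rewrite sumrMnl -mulr_suml -mulr_sumr.
rewrite -(mulr_natl (M ^+ 2)) => h.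
have : 0 <= #|A|%:R * (#|A|%:R * Q - M ^+ 2) by lra.
by rewrite (pmulr_rge0 _ Ap') subr_ge0.
Qed.

(** The sum over functions factors over the coordinates, and the factor at [v1] is the sum of [a],
    which vanishes. *)
Lemma sum_ffun_indep (V I : finType) (a b : I -> F) v1 v2 : v1 != v2 ->
  \sum_i a i = 0 -> \sum_(u : {ffun V -> I}) a (u v1) * b (u v2) = 0.
Proof.
move=> ne a0.
pose c v i := if v == v1 then a i else if v == v2 then b i else 1.
transitivity (\sum_(u : {ffun V -> I}) \prod_v c v (u v)).
  apply: eq_bigr => u _; rewrite (bigD1 v1) //= (bigD1 v2) 1?eq_sym //=.
  rewrite big1 ?mulr1 /c => [|v /andP[/negbTE -> /negbTE -> //]].
  by rewrite !eqxx eq_sym (negbTE ne).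
rewrite -bigA_distr_bigA (bigD1 v1) //= [X in X * _](_ : _ = 0) ?mul0r //.
by rewrite -[RHS]a0; apply: eq_bigr => i _; rewrite /c eqxx.
Qed.

Variables (O V : finType) (s : nat) (g : 'I_s -> O -> O -> bool).
Hypothesis s_gt0 : (0 < s)%N.

Local Notation T := (O * ({ffun V -> 'I_s} * V))%type.

(* The level r is selected by the coordinate v of a random function u : a fixed
   pair of distinct coordinates is exactly pairwise independent. *)
Definition blowup (x y : T) : bool := g (x.2.1 y.2.2) x.1 y.1.

Definition blowup_error (x y : T) : F :=
  (blowup x y)%:R - (\sum_r (g r x.1 y.1)%:R) / s%:R.

Lemma blowup_error_le1 x y : `|blowup_error x y| <= 1.
Proof.
have h0 : 0 <= (\sum_r (g r x.1 y.1)%:R) / s%:R :> F.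
  by rewrite divr_ge0 ?ler0n ?sumr_ge0.
have h1 : (\sum_r (g r x.1 y.1)%:R) / s%:R <= 1 :> F.
  rewrite ler_pdivrMr ?ltr0n // mul1r.
  rewrite (@le_trans _ _ (\sum_(r < s) 1)) //.
    by apply: ler_sum => r _; rewrite lern1 leq_b1.
  by rewrite sumr_const card_ord.
rewrite ler_norml /blowup_error; case: blowup => /=; lra.
Qed.

(** For fixed [o] and [v], the two errors depend on two different coordinates of [u], and each has
    mean zero. *)
Lemma blowup_error_orth y y' : y.2.2 != y'.2.2 ->
  \sum_x blowup_error x y * blowup_error x y' = 0.
Proof.
move=> ne.
pose a (z : T) (o : O) (r : 'I_s) : F :=
  (g r o z.1)%:R - (\sum_r (g r o z.1)%:R) / s%:R.
have a0 z o : \sum_r a z o r = 0.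
  rewrite sumrB sumr_const card_ord -(mulr_natr (_ / _)) divfK ?subrr //.
  by rewrite pnatr_eq0 -lt0n.
rewrite -(pair_bigA _ (fun o w => blowup_error (o, w) y * blowup_error (o, w) y')).
rewrite big1 // => o _.
rewrite -(pair_bigA _ (fun u v => blowup_error (o, (u, v)) y *
                                  blowup_error (o, (u, v)) y')) exchange_big.
rewrite big1 // => v _.
exact: (sum_ffun_indep (a y' o) ne (a0 y o)).
Qed.

(** Second moment: after Cauchy-Schwarz over [x] and expansion of the square, only pairs [y], [y']
    with equal [V]-coordinate remain, that is [|T| / |V|] of them for each [y]. *)
Lemma discrepancy (S R : {set T}) :
  #|V|%:R * (\sum_(x in S) \sum_(y in R) blowup_error x y) ^+ 2 <= #|{: T}|%:R ^+ 4.
Proof.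
have V0 := ler0n F #|V|; set N : F := #|{: T}|%:R.
have N0 : 0 <= N by exact: ler0n.
have cN (A : {set T}) : #|A|%:R <= N by rewrite ler_nat max_card.
pose h x := \sum_(y in R) blowup_error x y.
have H1 : (\sum_(x in S) h x) ^+ 2 <= N * \sum_x h x ^+ 2.
  apply: le_trans (sqr_sum_le S h) _; apply: ler_pM => //.
    by apply: sumr_ge0 => x _; exact: sqr_ge0.
  rewrite [X in X <= _]big_mkcond; apply: ler_sum => x _.
  by case: ifP => // _; exact: sqr_ge0.
have cV (v : V) : #|V|%:R * #|[set y : T | y.2.2 == v]|%:R = N.
  rewrite -natrM /N; congr (_%:R).
  have -> : [set y : T | y.2.2 == v] = setX setT (setX setT [set v]).
    by apply/setP => y; rewrite !inE.
  by rewrite !cardsX !cardsT cards1 !card_prod; ring.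
have H2 : #|V|%:R * \sum_x h x ^+ 2 <= N ^+ 3.
  have -> : \sum_x h x ^+ 2 =
     \sum_(y in R) \sum_(y' in R) \sum_x blowup_error x y * blowup_error x y'.
    under [RHS]eq_bigr => y _ do rewrite exchange_big /=.
    rewrite [RHS]exchange_big /=; apply: eq_bigr => x _.
    rewrite expr2 /h mulr_suml; apply: eq_bigr => y _.
    by rewrite mulr_sumr.
  have -> : N ^+ 3 = N * (N * N) by rewrite exprSr expr2; ring.
  rewrite mulr_sumr.
  apply: le_trans (_ : \sum_(y in R) N * N <= _); last first.
    by rewrite sumr_const -mulr_natl ler_wpM2r ?mulr_ge0.
  apply: ler_sum => y _.
  rewrite -{1}(cV y.2.2) -mulrA ler_wpM2l // mulr_natl -sumr_const.
  rewrite big_mkcond [X in _ <= X]big_mkcond /=; apply: ler_sum => y' _.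
  rewrite inE; have [E|ne] := eqVneq y'.2.2 y.2.2; last first.
    by rewrite blowup_error_orth ?if_same // eq_sym.
  case: ifP => // _; rewrite -[N]/(#|{: T}|%:R) -sumr_const.
  apply: ler_sum => x _.
  have := ler_pM (normr_ge0 _) (normr_ge0 _) (blowup_error_le1 x y)
    (blowup_error_le1 x y').
  by rewrite -normrM mulr1; apply: le_trans; exact: ler_norm.
have -> : N ^+ 4 = N * N ^+ 3 by rewrite exprS.
apply: le_trans (ler_wpM2l V0 H1) _.
by rewrite mulrCA ler_wpM2l.
Qed.

End BlowUp.

(** * Every bipartite graph as a common link in a member of the property *)

Section Embedding.

Lemma imset3 (A B : finType) (f : A -> B) x y z :
  f @: [set x; y; z] = [set f x; f y; f z].
Proof. by rewrite !imsetU !imset_set1. Qed.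

Lemma cards3_distinct (A : finType) (x y z : A) : #|[set x; y; z]| = 3 ->
  [/\ x != y, x != z & y != z].
Proof.
rewrite setUC cardsU1 cards2 !inE negb_or !(eq_sym z).
by case: (x == y); case: (x == z); case: (y == z).
Qed.

Lemma mem_trip_edges n (E : {set {set 'I_n}}) (p q r : 'I_3) (x y z : 'I_n) :
  p != q -> p != r -> q != r ->
  ([set (p, x); (q, y); (r, z)] \in trip_edges E) = ([set x; y; z] \in E).
Proof.
move=> pq pr qr; apply/imsetP/idP => [[[[x' y'] z']]|xyz].
  rewrite inE /= => H /(congr1 (fun A : {set 'I_3 * 'I_n} => snd @: A)).
  by rewrite !imset3 /= => ->.
have perm3 (A : finType) (u v w : A) :
    [/\ [set u; v; w] = [set u; w; v], [set u; v; w] = [set v; u; w],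
       [set u; v; w] = [set v; w; u], [set u; v; w] = [set w; u; v]
     & [set u; v; w] = [set w; v; u]].
  by split; apply/setP => e; rewrite !inE; do 3!case: (e == _).
have I3 (o : 'I_3) : [\/ o = inord 0, o = inord 1 | o = inord 2].
  rewrite -[o]inord_val; case: o => -[|[|[|//]]] /= lt.
  - by constructor 1.
  - by constructor 2.
  - by constructor 3.
have [e1 e2 e3 e4 e5] := perm3 _ x y z.
have [f1 f2 f3 f4 f5] := perm3 _ (p, x) (q, y) (r, z).
move: pq pr qr f1 f2 f3 f4 f5.
case: (I3 p) => ->; case: (I3 q) => ->; case: (I3 r) => ->; rewrite ?eqxx //.
- by move=> *; exists (x, y, z); rewrite ?inE.
- by move=> _ _ _ f *; exists (x, z, y); rewrite ?inE //= -e1.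
- by move=> _ _ _ _ f *; exists (y, x, z); rewrite ?inE //= -e2.
- by move=> _ _ _ _ _ _ f *; exists (z, x, y); rewrite ?inE //= -e4.
- by move=> _ _ _ _ _ f *; exists (y, z, x); rewrite ?inE //= -e3.
- by move=> _ _ _ _ _ _ _ f; exists (z, y, x); rewrite ?inE //= -e5.
Qed.

Lemma trip_edges_distinct n (E : {set {set 'I_n}}) (u v w : 'I_3 * 'I_n) :
  [set u; v; w] \in trip_edges E -> [/\ u.1 != v.1, u.1 != w.1 & v.1 != w.1].
Proof.
case/imsetP=> t _ /(congr1 (fun A : {set 'I_3 * 'I_n} => #|fst @: A|)).
rewrite !imset3 /= => H; apply: cards3_distinct; rewrite H.
by rewrite setUC cardsU1 cards2 !inE -!(inj_eq val_inj) /= !inordK.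
Qed.

Lemma ord3_third (p q r o : 'I_3) :
  p != q -> p != r -> q != r -> o != q -> o != r -> o = p.
Proof.
rewrite -!(inj_eq val_inj) /= => *; apply/val_inj => /=.
have := ltn_ord p; have := ltn_ord q; have := ltn_ord r; have := ltn_ord o; lia.
Qed.

Lemma mem_kUk_edges k (i j : 'I_k) (S : {set 'I_k}) :
  ([set (inr i : kUk_vertex k); inl (inl j); inl (inr S)] \in kUk_edges k) = (j \in S).
Proof.
apply/imsetP/idP => [[[[j' S'] i']]|jS]; last by exists (j, S, i); rewrite ?inE.
rewrite inE /= => j'S' /setP E.
have := E (inl (inl j)); rewrite !inE eqxx orbT => /esym /=.
rewrite orbF => /eqP[->].
by have := E (inl (inr S)); rewrite !inE eqxx orbT => /esym /= /eqP[->].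
Qed.

Variables (P : prop3) (T : finType) (g : T -> T -> bool).
Hypotheses (hP : hereditary3 P) (T_gt0 : 0 < #|T|).
Hypothesis hTrip : forall k : nat, 1 <= k -> trip_contains P (kUk_edges k).

(** Vertices of [Trip] in different layers may come from the same vertex of the underlying 3-graph.
    The images under [f] must therefore be placed in fixed layers and then kept distinct after the
    layer is forgotten. *)
Theorem embed_bipartite :
  exists n (E : {set {set 'I_n}}), P E /\ n = 3 * #|T| /\
  exists a b c : T -> 'I_n, [/\ injective a, injective b, injective c &
    forall w x y, ([set c w; a x; b y] \in E) = g x y].
Proof.
(* The summand [T] indexes the rows [x]. The elements [(y, i)] are tags making neighbourhoods
   nonempty and distinct, with [|T| + 1] versions for each [y]. *)
pose J := (T + T * option T)%type; pose k := #|{: J}|.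
have k0 : 0 < k.
  by case/card_gt0P: T_gt0 => t _; apply/card_gt0P; exists (inl t : J).
have [n0 [E0 [PE0 [f [injf Hf]]]]] := hTrip k0.
have [E3 her] := hP PE0.
pose cv (i : 'I_k) : kUk_vertex k := inr i; pose av (j : 'I_k) : kUk_vertex k := inl (inl j).
pose bv (S : {set 'I_k}) : kUk_vertex k := inl (inr S).
have mem (i j : 'I_k) (S : {set 'I_k}) : ([set f (cv i); f (av j); f (bv S)] \in trip_edges E0) = (j \in S).
  by rewrite -imset3 -Hf mem_kUk_edges.
have dist (i j : 'I_k) (S : {set 'I_k}) : j \in S -> [/\ (f (cv i)).1 != (f (av j)).1,
   (f (cv i)).1 != (f (bv S)).1 & (f (av j)).1 != (f (bv S)).1].
  by move=> jS; apply: (@trip_edges_distinct _ E0); rewrite mem.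
pose i0 : 'I_k := Ordinal k0; pose full : {set 'I_k} := setT.
(* An edge meets all three layers, so comparison with a fixed edge determines the layer of every
   [c], every [a], and every [b] with nonempty neighbourhood. *)
have [ca cb ab] := dist i0 i0 full (in_setT _).
have fc i : (f (cv i)).1 = (f (cv i0)).1.
  by have [h1 h2 _] := dist i i0 full (in_setT _); apply: ord3_third ca cb ab _ _.
have fa j : (f (av j)).1 = (f (av i0)).1.
  have [h1 _ h2] := dist i0 j full (in_setT _).
  by apply: (ord3_third (q := (f (cv i0)).1) (r := (f (bv full)).1)) => //; rewrite eq_sym.
have fb (j : 'I_k) (S : {set 'I_k}) : j \in S -> (f (bv S)).1 = (f (bv full)).1.
  move=> jS; have [_ h1 h2] := dist i0 j S jS; rewrite fa in h2.
  by apply: (ord3_third (q := (f (cv i0)).1) (r := (f (av i0)).1)) => //; rewrite eq_sym.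
have inj2 u v : (f u).1 = (f v).1 -> (f u).2 = (f v).2 -> u = v.
  by move=> e1 e2; apply: injf; move: e1 e2; case: (f u) (f v) => [? ?] [? ?] /= -> ->.
have key (i j j' : 'I_k) (S : {set 'I_k}) : j' \in S ->
    ([set (f (cv i)).2; (f (av j)).2; (f (bv S)).2] \in E0) = (j \in S).
  move=> jS; rewrite -(mem i j S) -(mem_trip_edges E0 _ _ _ ca cb ab).
  by rewrite -(fc i) -(fa j) -(fb _ _ jS) -!surjective_pairing.
pose er x : 'I_k := enum_rank (inl x : J).
pose nbr y i : {set 'I_k} :=
  [set j | match enum_val j : J with inl x => g x y | inr p => p == (y, i) end].
have nbr_mem y i : enum_rank (inr (y, i) : J) \in nbr y i.
  by rewrite inE enum_rankK.
have nbr_inj y i y' i' : nbr y i = nbr y' i' -> (y, i) = (y', i').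
  by move=> E; have := nbr_mem y i; rewrite E inE enum_rankK => /eqP.
have inj_nbr y i y' i' : (f (bv (nbr y i))).2 = (f (bv (nbr y' i'))).2 ->
    (y, i) = (y', i').
  move=> E; apply: nbr_inj.
  suff [] : bv (nbr y i) = bv (nbr y' i') by [].
  by apply: inj2 E; rewrite !(fb _ _ (nbr_mem _ _)).
(* Pigeonhole: the [|T| + 1] versions of [y] have distinct images, and at most [|T|] vertices must
   be avoided. *)
have avoid y : exists i, forall x, (f (bv (nbr y i))).2 != (f (av (er x))).2.
  have [|] := boolP [exists i, forall x, (f (bv (nbr y i))).2 != (f (av (er x))).2].
    by case/existsP => i /forallP; exists i.
  rewrite negb_exists => /forallP none.
  suff : #|{: option T}| <= #|T| by rewrite card_option ltnn.
  have inj_i : injective (fun i => (f (bv (nbr y i))).2).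
    by move=> i i' /inj_nbr[].
  rewrite -(card_imset _ inj_i).
  apply: leq_trans (leq_imset_card (fun x => (f (av (er x))).2) _).
  apply/subset_leq_card/subsetP => _ /imsetP[i _ ->].
  move: (none i); rewrite negb_forall => /existsP[x]; rewrite negbK => /eqP ->.
  exact: imset_f.
have [h Hh] := fin_all_exists avoid.
pose phi (t : T + T + T) : 'I_n0 :=
  match t with
  | inl (inl x) => (f (av (er x))).2
  | inl (inr y) => (f (bv (nbr y (h y)))).2
  | inr w => (f (cv (er w))).2
  end.
have keyphi w x y : ([set phi (inr w); phi (inl (inl x)); phi (inl (inr y))] \in E0) = g x y.
  by rewrite /phi (key _ _ _ _ (nbr_mem y (h y))) inE enum_rankK.
have er_inj : injective er by move=> x y /enum_rank_inj[].
(* Both vertices lie in a common edge, which has three elements. *)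
have ac x w : (f (av (er x))).2 != (f (cv (er w))).2.
  have := key (er w) (er x) i0 full (in_setT _); rewrite in_setT.
  by move/E3/cards3_distinct => [+ _ _]; rewrite eq_sym.
have bc y w : (f (bv (nbr y (h y)))).2 != (f (cv (er w))).2.
  have := key (er w) (enum_rank (inr (y, h y) : J)) _ _ (nbr_mem y (h y)); rewrite (nbr_mem y (h y)).
  by move/E3/cards3_distinct => [_ + _]; rewrite eq_sym.
have phi_inj : injective phi.
  move=> [[x|y]|w] [[x'|y']|w'] /= E.
  - by have [/er_inj ->] : av (er x) = av (er x') by apply: inj2 E; rewrite !(fa (er _)).
  - by have := Hh y' x; rewrite E eqxx.
  - by have := ac x w'; rewrite E eqxx.
  - by have := Hh y x'; rewrite E eqxx.
  - by have [->] := inj_nbr _ _ _ _ E.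
  - by have := bc y w'; rewrite E eqxx.
  - by have := ac x' w; rewrite E eqxx.
  - by have := bc y' w; rewrite E eqxx.
  - by have [/er_inj ->] : cv (er w) = cv (er w') by apply: inj2 E; rewrite !(fc (er _)).
pose X := (T + T + T)%type.
pose F (o : 'I_#|{: X}|) := phi (enum_val o).
have Finj : injective F by move=> o o' /phi_inj /enum_val_inj.
exists #|{: X}|, [set e : {set 'I_#|{: X}|} | F @: e \in E0].
split; first exact: her.
split; first by rewrite !card_sum; lia.
exists (fun x => enum_rank (inl (inl x) : X)), (fun y => enum_rank (inl (inr y) : X)),
  (fun w => enum_rank (inr w : X)); split.
- by move=> x y /enum_rank_inj[].
- by move=> x y /enum_rank_inj[].
- by move=> x y /enum_rank_inj[].
- by move=> w x y; rewrite inE imset3 /F !enum_rankK keyphi.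
Qed.

End Embedding.

(** * From 3-graph partitions to bipartite ones *)

Section LowerBound.

Local Open Scope ring_scope.

Lemma densE (V : finType) (E : {set {set V}}) X Y Z :
  dens E X Y Z =
  #|[set t : V * V * V | [&& t.1.1 \in X, t.1.2 \in Y & t.2 \in Z]
        && ([set t.1.1; t.1.2; t.2] \in E)]|%:R /
  (#|X|%:R * #|Y|%:R * #|Z|%:R) :> R.
Proof.
rewrite /dens RdivE !RmultE !INRE; congr (_%:R / _).
by apply: eq_card => t; rewrite !inE !andbA.
Qed.

Lemma pbP (Q : Prop) : reflect Q (pb Q).
Proof. by rewrite /pb; case: excluded_middle_informative => H; constructor. Qed.

Lemma reg_tripleP (V : finType) (E : {set {set V}}) (eps : R) X Y Z :
  reg_triple E eps X Y Z <->
  forall X' Y' Z' : {set V}, X' \subset X -> Y' \subset Y -> Z' \subset Z ->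
    eps * #|X|%:R <= #|X'|%:R -> eps * #|Y|%:R <= #|Y'|%:R ->
    eps * #|Z|%:R <= #|Z'|%:R ->
    `|dens E X Y Z - dens E X' Y' Z'| <= eps.
Proof.
split=> H X' Y' Z' hX hY hZ h1 h2 h3.
  rewrite -RabsE -RminusE; apply/RleP; apply: H => //;
    by rewrite !INRE; apply/RleP.
apply/RleP; rewrite RabsE RminusE; apply: H => //;
  by apply/RleP; rewrite -!INRE.
Qed.

Lemma card_small_fibers (F : realFieldType) (T L : finType) (z : T -> L)
  (Q : {set L}) (f : L -> F) : (forall x, z x \in Q) -> (forall l, 0 <= f l) ->
  #|[set x | #|fiber z (z x)|%:R < f (z x)]|%:R <= \sum_(l in Q) f l.
Proof.
move=> zQ f0.
rewrite -sum1dep_card big_mkcond natr_sum /=.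
rewrite (partition_big z [in Q]) => [|x _] //=; apply: ler_sum => l _.
have [lt|ge] := ltP #|fiber z l|%:R (f l); last first.
  by rewrite big1 // => x /eqP ->; rewrite ltNge ge.
apply: le_trans (ltW lt); rewrite -sum1_card natr_sum.
rewrite (eq_bigl [in fiber z l]) => [|x]; last by rewrite inE.
by apply: ler_sum => x _; case: ifP.
Qed.

Lemma card_triples (T : finType) (p : T -> T * T -> bool) :
  #|[set t : T * T * T | p t.1.1 (t.1.2, t.2)]| = (\sum_x #|[set q | p x q]|)%N.
Proof.
rewrite -sum1dep_card big_mkcond.
rewrite -(pair_bigA _ (fun q y => if p q.1 (q.2, y) then 1 else 0)%N) /=.
rewrite -(pair_bigA _ (fun x x' => \sum_y if p x (x', y) then 1 else 0)%N) /=.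
apply: eq_bigr => x _; rewrite -sum1dep_card [RHS]big_mkcond.
by rewrite pair_bigA; apply: eq_bigr => -[].
Qed.

Variables (T : finType) (n : nat) (E : {set {set 'I_n}}).
Variables (a b c : T -> 'I_n) (g : T -> T -> bool).
Hypotheses (inja : injective a) (injb : injective b) (injc : injective c).
Hypothesis memE : forall w x y, ([set c w; a x; b y] \in E) = g x y.

(** The first set cancels, since all vertices [c w] have the same link. *)
Lemma dens_slices (W S U : {set T}) : (0 < #|W|)%N -> (0 < #|S|)%N -> (0 < #|U|)%N ->
  dens E (c @: W) (a @: S) (b @: U) * (#|S|%:R * #|U|%:R) =
  \sum_(x in S) \sum_(y in U) (g x y)%:R :> R.
Proof.
move=> W0 S0 U0; rewrite densE !card_imset //.
have -> : #|[set t : 'I_n * 'I_n * 'I_n |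
     [&& t.1.1 \in c @: W, t.1.2 \in a @: S & t.2 \in b @: U]
        && ([set t.1.1; t.1.2; t.2] \in E)]| =
   (#|W| * \sum_(x in S) \sum_(y in U) g x y)%N.
  pose h (t : T * T * T) := (c t.1.1, a t.1.2, b t.2).
  have injh : injective h.
    by move=> [[w x] y] [[w' x'] y'] [/injc -> /inja -> /injb ->].
  transitivity #|h @: [set t : T * T * T | [&& t.1.1 \in W, t.1.2 \in S & t.2 \in U]
       && g t.1.2 t.2]|.
    apply: eq_card => -[[i j] k]; rewrite inE /=; apply/idP/imsetP.
      case/andP=> /and3P[/imsetP[w wW ->] /imsetP[x xS ->] /imsetP[y yU ->]].
      by rewrite memE => gxy; exists (w, x, y) => //; rewrite inE /= wW xS yU.
    case=> -[[w x] y]; rewrite inE /= => /andP[/and3P[wW xS yU] gxy] [-> -> ->].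
    by rewrite !imset_f // memE.
  rewrite card_imset // -sum1dep_card big_mkcond /=.
  rewrite -(pair_bigA _ (fun p y => if [&& p.1 \in W, p.2 \in S & y \in U] && g p.2 y
     then 1 else 0)%N) /=.
  rewrite -(pair_bigA _ (fun w x => \sum_y if [&& w \in W, x \in S & y \in U] && g x y
     then 1 else 0)%N) /=.
  rewrite -sum_nat_const [RHS]big_mkcond; apply: eq_bigr => w _.
  case: (w \in W); last by rewrite big1 // => x _; rewrite big1.
  rewrite [RHS]big_mkcond; apply: eq_bigr => x _.
  case: (x \in S); last by rewrite big1.
  rewrite [RHS]big_mkcond; apply: eq_bigr => y _.
  by case: (y \in U) (g x y) => [] [].
rewrite natrM natr_sum; under [in LHS]eq_bigr do rewrite natr_sum.
by field; rewrite !pnatr_eq0 -!lt0n W0 S0 U0.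
Qed.

Lemma slice_density (eps : R) (X Y Z : {set 'I_n}) (W S U : {set T}) :
  reg_triple E eps X Y Z ->
  c @: W \subset X -> a @: S \subset Y -> b @: U \subset Z ->
  eps * #|X|%:R <= #|W|%:R -> eps * #|Y|%:R <= #|S|%:R ->
  eps * #|Z|%:R <= #|U|%:R ->
  (0 < #|W|)%N -> (0 < #|S|)%N -> (0 < #|U|)%N ->
  `|(\sum_(x in S) \sum_(y in U) (g x y)%:R) - dens E X Y Z * (#|S|%:R * #|U|%:R)|
    <= eps * (#|S|%:R * #|U|%:R).
Proof.
move=> /reg_tripleP reg WX SY UZ hW hS hU W0 S0 U0.
rewrite -(dens_slices W0 S0 U0) -mulrBl normrM distrC.
rewrite [X in _ * X]ger0_norm ?mulr_ge0 ?ler0n // ler_wpM2r ?mulr_ge0 ?ler0n //.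
by apply: reg; rewrite ?card_imset.
Qed.

Variables (s : nat) (chi : nat -> T -> nat) (side : nat -> T -> nat -> bool).
Local Notation G := (edge_weight s chi side R).
Local Notation N := (#|T|%:R : R).

Variables (d : nat) (eps e1 : R) (M : nat) (Q : {set {set 'I_n}}).
Hypothesis disc : forall S U : {set T},
  d%:R * (\sum_(x in S) \sum_(y in U) ((g x y)%:R - G x y)) ^+ 2 <= N ^+ 4.
Hypotheses (T_gt0 : (0 < #|T|)%N) (nE : n = (3 * #|T|)%N).
Hypotheses (eps_gt0 : 0 < eps) (e1_gt0 : 0 < e1) (e1_small : e1 <= 1 / 100%:R).
Hypotheses (eps_small : eps <= e1 ^+ 2) (QM : (#|Q| <= M)%N).
Hypothesis d_large : (M%:R ^+ 2) ^+ 2 < d%:R * (e1 ^+ 5) ^+ 2.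
Hypothesis regQ : reg_partition E eps Q.

Let z x := pblock Q (a x).
Let w y := pblock Q (b y).
Let v x := pblock Q (c x).

Let Qpart : partition Q setT. Proof. by case: regQ. Qed.

Let pblockQ (o : 'I_n) : pblock Q o \in Q.
Proof. by apply: pblock_mem; rewrite (cover_partition Qpart) in_setT. Qed.

Let mem_block (o : 'I_n) : o \in pblock Q o.
Proof. by rewrite mem_pblock (cover_partition Qpart) in_setT. Qed.

Let T0 : 0 < N. Proof. by rewrite ltr0n. Qed.

Let M0 : 0 < M%:R :> R.
Proof.
rewrite ltr0n; apply: leq_trans QM; apply/card_gt0P.
by case/card_gt0P: T_gt0 => x _; exists (z x); exact: pblockQ.
Qed.

Let sum_blocks (t : R) : \sum_(l in Q) t * #|l|%:R = t * (3%:R * N).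
Proof.
rewrite -mulr_sumr -natr_sum -(card_partition Qpart) cardsT card_ord nE.
by rewrite natrM.
Qed.

(** The factor 27 is [(n / |T|)^3]. *)
Lemma card_irregular_triples :
  #|[set t : T * T * T | ~~ pb (reg_triple E eps (v t.1.1) (z t.1.2) (w t.2))]|%:R
    <= 27%:R * eps * N ^+ 3.
Proof.
have [_ /RleP] := regQ.
have nR : n%:R = 3%:R * N :> R by rewrite [in LHS]nE natrM.
rewrite !INRE RpowE !RmultE RminusE card_ord nR.
set B := [set t | _] => H.
have : #|[set t : T * T * T | ~~ pb (reg_triple E eps (v t.1.1) (z t.1.2) (w t.2))]|%:R
   <= #|~: B|%:R :> R.
  pose h (t : T * T * T) := (c t.1.1, a t.1.2, b t.2).
  have injh : injective h.
    by move=> [[x y] u] [[x' y'] u'] [/injc -> /inja -> /injb ->].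
  rewrite ler_nat -(card_imset _ injh) subset_leq_card //.
  apply/subsetP => _ /imsetP[t + ->]; rewrite !inE /=; apply: contra.
  case/pbP => X [Y [Z [XQ YQ ZQ /andP[/andP[tX tY] tZ] reg]]]; apply/pbP.
  have tr := partition_trivIset Qpart.
  by rewrite /v /z /w !(def_pblock tr _ tX, def_pblock tr _ tY, def_pblock tr _ tZ).
have := cardsC B; rewrite !card_prod card_ord => /(congr1 (fun k => k%:R : R)).
rewrite natrD !natrM nR => h1 h2; apply: le_trans h2 _.
move: H h1; rewrite R1E => H h1.
have : (3%:R * N) ^+ 3 = 3%:R * N * (3%:R * N) * (3%:R * N) by ring.
have : 27%:R * eps * N ^+ 3 = eps * (3%:R * N) ^+ 3 by ring.
lra.
Qed.

Lemma exists_good_slice : exists2 x0 : T,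
  eps * #|v x0|%:R <= #|fiber v (v x0)|%:R &
  #|[set p : T * T | ~~ pb (reg_triple E eps (v x0) (z p.1) (w p.2))]|%:R
    <= 60%:R * eps * N ^+ 2.
Proof.
have e0 := eps_gt0; have e1p := e1_gt0; have e1s := e1_small; have es := eps_small.
have eps100 : eps <= 100%:R^-1 by nra.
apply: NNPP => none.
pose bad := [set x | #|fiber v (v x)|%:R < eps * #|v x|%:R].
have cbad : #|bad|%:R <= eps * (3%:R * N).
  rewrite -sum_blocks.
  by apply: (@card_small_fibers R T _ v Q (fun l => eps * #|l|%:R)) => [x|l];
    [exact: pblockQ | rewrite mulr_ge0 // ltW].
pose cnt x0 := #|[set p : T * T | ~~ pb (reg_triple E eps (v x0) (z p.1) (w p.2))]|.
have : \sum_(x in ~: bad) 60%:R * eps * N ^+ 2 <= \sum_(x in ~: bad) (cnt x)%:R.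
  apply: ler_sum => x; rewrite !inE -leNgt => ok.
  by rewrite leNgt; apply/negP => lt; apply: none; exists x => //; exact: ltW.
rewrite sumr_const -(mulr_natl (_ * _ ^+ 2)).
have : \sum_(x in ~: bad) (cnt x)%:R <= 27%:R * eps * N ^+ 3.
  apply: le_trans card_irregular_triples.
  rewrite (card_triples (fun x0 p => ~~ pb (reg_triple E eps (v x0) (z p.1) (w p.2)))).
  rewrite -natr_sum ler_nat big_mkcond; apply: leq_sum => x0 _.
  by case: ifP.
have : N - #|bad|%:R = #|~: bad|%:R.
  have := cardsC bad => /(congr1 (fun k => k%:R : R)); rewrite natrD; lra.
move=> h0 h1 h2; have := le_trans h2 h1.
have gN : N / 2%:R <= #|~: bad|%:R by have := T0; nra.
have p0 : 0 < eps * N ^+ 2 by rewrite mulr_gt0 // exprn_gt0.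
have : N / 2%:R * (60%:R * eps * N ^+ 2) <= #|~: bad|%:R * (60%:R * eps * N ^+ 2).
  by rewrite ler_wpM2r // -mulrA mulr_ge0 // ltW.
have : 0 < (eps * N ^+ 2) * N by rewrite mulr_gt0.
have -> : 27%:R * eps * N ^+ 3 = 27%:R * (eps * N ^+ 2 * N) by rewrite exprSr; ring.
lra.
Qed.

Section Slice.

Variable x0 : T.
Hypothesis x0_good : eps * #|v x0|%:R <= #|fiber v (v x0)|%:R.

(** The bounds relative to [#|l|] and [#|l'|] let subsets of the fibers serve as test sets for the
    parts; those by [e1 * N / M] keep the fibers above the discrepancy. *)
Let rho (l l' : {set 'I_n}) : bool :=
  [&& pb (reg_triple E eps (v x0) l l'),
      e1 * #|l|%:R <= #|fiber z l|%:R, e1 * #|l'|%:R <= #|fiber w l'|%:R,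
      e1 * N / M%:R <= #|fiber z l|%:R & e1 * N / M%:R <= #|fiber w l'|%:R].

Let e := 100%:R * e1.

(** The error is at most [eps] from regularity plus [e1] from replacing [g] by the average [G]. *)
Lemma slice_weight l l' (S U : {set T}) : rho l l' ->
  S \subset fiber z l -> U \subset fiber w l' ->
  e * #|fiber z l|%:R <= #|S|%:R -> e * #|fiber w l'|%:R <= #|U|%:R ->
  `|(\sum_(x in S) \sum_(y in U) G x y) -
      dens E (v x0) l l' * (#|S|%:R * #|U|%:R)| <= 2%:R * e1 * (#|S|%:R * #|U|%:R).
Proof.
case/and5P=> /pbP reg zl wl' zbig wbig Sz Uw Sbig Ubig.
have e0 := eps_gt0; have e1p := e1_gt0; have e1s := e1_small; have es := eps_small.
have Np := T0; have Mp := M0.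
pose q := e1 ^+ 2 * (N / M%:R).
have qp : 0 < q by rewrite mulr_gt0 ?exprn_gt0 ?divr_gt0.
have scale (A : {set T}) (B : {set T}) : e1 * N / M%:R <= #|B|%:R -> e * #|B|%:R <= #|A|%:R ->
    q <= #|A|%:R.
  move=> h1 h2; have := ler_wpM2l (ltW e1p) h1.
  have -> : e1 * (e1 * N / M%:R) = q by rewrite /q expr2 !mulrA.
  have : 0 <= e1 * #|B|%:R by rewrite mulr_ge0 // ltW.
  by move: h2; rewrite /e; lra.
have Sq := scale _ _ zbig Sbig; have Uq := scale _ _ wbig Ubig.
have S0 : 0 < #|S|%:R :> R by exact: lt_le_trans Sq.
have U0 : 0 < #|U|%:R :> R by exact: lt_le_trans Uq.
have SU0 : 0 < #|S|%:R * #|U|%:R :> R by rewrite mulr_gt0.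
have dense (l0 : {set 'I_n}) (B A : {set T}) : e1 * #|l0|%:R <= #|B|%:R ->
    e * #|B|%:R <= #|A|%:R -> eps * #|l0|%:R <= #|A|%:R.
  move=> h1 h2; have := ler_wpM2r (ler0n R #|l0|) es.
  have : 0 <= e1 * #|B|%:R by rewrite mulr_ge0 // ltW.
  have := ler_wpM2l (ltW e1p) h1; rewrite mulrA -expr2.
  by move: h2; rewrite /e; lra.
have sub (f : T -> 'I_n) (l0 : {set 'I_n}) (A : {set T}) :
    A \subset fiber (fun x => pblock Q (f x)) l0 -> f @: A \subset l0.
  move=> /subsetP As; apply/subsetP => _ /imsetP[x /As xl ->].
  by move: xl; rewrite inE => /eqP <-; exact: mem_block.
have h1 : `|(\sum_(x in S) \sum_(y in U) (g x y)%:R) -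
      dens E (v x0) l l' * (#|S|%:R * #|U|%:R)| <= eps * (#|S|%:R * #|U|%:R).
  apply: (slice_density (W := fiber v (v x0))) reg _ _ _ x0_good _ _ _ _ _.
  - exact: sub.
  - exact: sub.
  - exact: sub.
  - exact: dense zl Sbig.
  - exact: dense wl' Ubig.
  - by apply/card_gt0P; exists x0; rewrite inE.
  - by rewrite -(ltr0n R).
  - by rewrite -(ltr0n R).
set D := \sum_(x in S) \sum_(y in U) ((g x y)%:R - G x y).
have h2 : `|D| <= e1 * (#|S|%:R * #|U|%:R).
  (* Both sets have at least [q] elements, so the discrepancy would exceed [e1 q^2], contradicting
     [disc] by the size of [d]. *)
  rewrite leNgt; apply/negP => lt.
  have qq : e1 * (q * q) <= e1 * (#|S|%:R * #|U|%:R).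
    by rewrite ler_pM2l // ler_pM // ltW.
  have := le_lt_trans qq lt.
  have q0 : 0 < e1 * (q * q) by exact: mulr_gt0 e1p (mulr_gt0 qp qp).
  move=> lt2; have lt3 : (e1 * (q * q)) ^+ 2 < D ^+ 2.
    by rewrite -[D ^+ 2]real_normK ?num_real // ltr_pXn2r ?nnegrE ?normr_ge0 ?(ltW q0).
  have := disc S U; rewrite -/D leNgt => /negP; apply.
  have dp : 0 < d%:R :> R.
    have h := lt_trans (_ : 0 < (M%:R ^+ 2) ^+ 2) d_large.
    have : 0 < d%:R * (e1 ^+ 5) ^+ 2 by apply: h; rewrite !exprn_gt0.
    by rewrite pmulr_lgt0 // !exprn_gt0.
  have h3 : d%:R * (e1 * (q * q)) ^+ 2 < d%:R * D ^+ 2 by rewrite ltr_pM2l.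
  apply: le_lt_trans h3.
  have -> : e1 * (q * q) = e1 ^+ 5 * (N ^+ 2 / M%:R ^+ 2).
    by rewrite /q; field; rewrite gt_eqF.
  have -> : d%:R * (e1 ^+ 5 * (N ^+ 2 / M%:R ^+ 2)) ^+ 2 =
     d%:R * (e1 ^+ 5) ^+ 2 / (M%:R ^+ 2) ^+ 2 * N ^+ 4.
    by field; rewrite gt_eqF.
  rewrite ler_peMl ?exprn_ge0 ?ler0n // ler_pdivlMr ?exprn_gt0 //.
  by rewrite mul1r ltW.
have eqD : \sum_(x in S) \sum_(y in U) G x y =
    (\sum_(x in S) \sum_(y in U) (g x y)%:R) - D.
  rewrite /D -sumrB; apply: eq_bigr => x _.
  by rewrite -sumrB; apply: eq_bigr => y _; rewrite opprB addrC subrK.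
rewrite eqD addrAC; apply: le_trans (ler_normB _ _) _.
have : eps * (#|S|%:R * #|U|%:R) <= e1 * (#|S|%:R * #|U|%:R).
  by rewrite ler_pM2r //; nra.
by lra.
Qed.

(** Both densities are within [2 e1] of the same number, so they differ by at most [4 e1 <= e]. *)
Lemma slice_regular : regular_pairs s chi side e z w rho.
Proof.
move=> l l' S S' U rl Sz S'z Uw Sb S'b Ub.
have := slice_weight rl Sz Uw Sb Ub; have := slice_weight rl S'z Uw S'b Ub.
rewrite sumrB -!mulr_suml ![\sum_(y in U) \sum_(x in _) _]exchange_big /=.
move: (\sum_(x in S) _) (\sum_(x in S') _) (dens _ _ _ _) => A A' D.
have [p p' r] : [/\ 0 <= #|S|%:R :> R, 0 <= #|S'|%:R :> R & 0 <= #|U|%:R :> R].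
  by split; exact: ler0n.
move: p p' r; rewrite /e; have := e1_gt0.
move: (#|S|%:R : R) (#|S'|%:R : R) (#|U|%:R : R) => p p' r e0 p0 p'0 r0.
rewrite !ler_distl => /andP[h1 _] /andP[_ h2].
have := ler_wpM2r p'0 h2; have := ler_wpM2r p0 h1.
have : 0 <= e1 * (p * p' * r) by rewrite !mulr_ge0 // ltW.
by lra.
Qed.

Lemma slice_regular_sym : regular_pairs s chi side e w z (fun l l' => rho l' l).
Proof.
move=> l' l S S' U rl Sz S'z Uw Sb S'b Ub.
have := slice_weight rl Uw Sz Ub Sb; have := slice_weight rl Uw S'z Ub S'b.
have sw (A : {set T}) : \sum_(y in U) \sum_(x in A) G x y =
   \sum_(x in U) \sum_(y in A) G x y.
  by apply: eq_bigr => y _; apply: eq_bigr => x _; rewrite edge_weightC.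
rewrite sumrB -!mulr_suml !sw.
move: (\sum_(x in U) \sum_(y in S) _) (\sum_(x in U) \sum_(y in S') _).
move: (dens _ _ _ _) => D A A'.
have [p p' r] : [/\ 0 <= #|S|%:R :> R, 0 <= #|S'|%:R :> R & 0 <= #|U|%:R :> R].
  by split; exact: ler0n.
move: p p' r; rewrite /e; have := e1_gt0.
move: (#|S|%:R : R) (#|S'|%:R : R) (#|U|%:R : R) => p p' r e0 p0 p'0 r0.
rewrite !ler_distl => /andP[h1 _] /andP[_ h2].
have := ler_wpM2r p'0 h2; have := ler_wpM2r p0 h1.
have : 0 <= e1 * (p * p' * r) by rewrite !mulr_ge0 // ltW.
by lra.
Qed.

(** In units of [N^2] the losses are [60 eps], then [3 e1] per side for thin fibers and [e1] per
    side for tiny ones: at most [68 e1] in all. *)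
Lemma card_irregular_pairs :
  #|[set p : T * T | ~~ pb (reg_triple E eps (v x0) (z p.1) (w p.2))]|%:R
    <= 60%:R * eps * N ^+ 2 ->
  #|[set p : T * T | ~~ rho (z p.1) (w p.2)]|%:R <= e * N ^+ 2.
Proof.
have e0 := eps_gt0; have e1p := e1_gt0; have e1s := e1_small; have es := eps_small.
have Np := T0; have Mp := M0.
set B := [set p | _] => cB.
pose B1 (u : T -> {set 'I_n}) := [set x | #|fiber u (u x)|%:R < e1 * #|u x|%:R].
pose B2 (u : T -> {set 'I_n}) := [set x | #|fiber u (u x)|%:R < e1 * N / M%:R].
have c1 (u : T -> {set 'I_n}) : (forall x, u x \in Q) -> #|B1 u|%:R <= e1 * (3%:R * N).
  move=> uQ; rewrite -sum_blocks.
  apply: (@card_small_fibers R T _ u Q (fun l => e1 * #|l|%:R)) => // l.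
  by rewrite mulr_ge0 // ltW.
have c2 (u : T -> {set 'I_n}) : (forall x, u x \in Q) -> #|B2 u|%:R <= e1 * N.
  move=> uQ; apply: le_trans (_ : \sum_(l in Q) (e1 * N / M%:R) <= _).
    apply: (@card_small_fibers R T _ u Q (fun l => e1 * N / M%:R)) => // l.
    by rewrite divr_ge0 ?mulr_ge0 // ltW.
  rewrite sumr_const -(mulr_natl (_ / _)) mulrCA ger_pMr ?mulr_gt0 //.
  by rewrite ler_pdivrMr // mul1r ler_nat.
have zQ x : z x \in Q by exact: pblockQ.
have wQ x : w x \in Q by exact: pblockQ.
pose C (A : {set T}) := setX A [set: T]; pose C' (A : {set T}) := setX [set: T] A.
have : (#|[set p : T * T | ~~ rho (z p.1) (w p.2)]| <=
   #|B| + #|C (B1 z)| + #|C' (B1 w)| + #|C (B2 z)| + #|C' (B2 w)|)%N.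
  apply: leq_trans (_ : #|B :|: C (B1 z) :|: C' (B1 w) :|: C (B2 z) :|: C' (B2 w)| <= _)%N.
    apply/subset_leq_card/subsetP => p; rewrite !inE /rho !andbT /=.
    by case: (pb _) => //=; rewrite !negb_and -!ltNge !orbA.
  do 4![apply: leq_trans (leq_card_setU _ _) _; rewrite leq_add2r].
  by [].
rewrite -(ler_nat R) !natrD /C /C' !cardsX !cardsT !natrM => h.
have hz1 := ler_wpM2r (ltW Np) (c1 z zQ); have hz2 := ler_wpM2r (ltW Np) (c2 z zQ).
have hw1 := ler_wpM2l (ltW Np) (c1 w wQ); have hw2 := ler_wpM2l (ltW Np) (c2 w wQ).
have p0 : 0 <= e1 * N ^+ 2 by rewrite mulr_ge0 ?exprn_ge0 // ltW.
have : eps * N ^+ 2 <= e1 * N ^+ 2 by rewrite ler_pM2r ?exprn_gt0 //; nra.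
move=> he; apply: le_trans h _; rewrite /e; move: he cB hz1 hz2 hw1 hw2 p0; rewrite expr2; lra.
Qed.

End Slice.

Variable m : nat -> nat.
Hypothesis sys : cluster_system s m chi side.
Hypotheses (s_gt0 : (0 < s)%N) (m0 : m 0 = 1%N).
Hypothesis s_small : 64%:R * 200%:R * s%:R ^+ 2 * (100%:R * e1) <= 1.

Theorem regular_partition_large : (m s <= 4 * M)%N.
Proof.
have [x0 good irr] := exists_good_slice.
have ep : 0 < 100%:R * e1 by rewrite mulr_gt0.
apply: leq_trans (many_labels sys s_gt0 ep s_small m0 T_gt0 (slice_regular good)
  (slice_regular_sym good) (card_irregular_pairs irr)) _.
rewrite leq_mul2l /=; apply: leq_trans QM; apply/subset_leq_card/subsetP.
by move=> _ /imsetP[x _ ->]; exact: pblockQ.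
Qed.

End LowerBound.

(** * Lower bound for an admissible number of parts *)

Section AdmissibleLower.

Local Open Scope ring_scope.

Theorem admissible_lower (P : prop3) (s M : nat) (eps e1 : R) :
  hereditary3 P -> (forall k, (1 <= k)%N -> trip_contains P (kUk_edges k)) ->
  (0 < s)%N -> 0 < eps -> 0 < e1 -> eps <= e1 ^+ 2 ->
  64%:R * 200%:R * s%:R ^+ 2 * (100%:R * e1) <= 1 ->
  MH_admissible P eps M -> (level_size s <= 4 * M)%N.
Proof.
move=> hP hTrip s0 eps0 e10 eps_e1 s_small [n0 adm].
pose B : R := (M%:R ^+ 2) ^+ 2 / (e1 ^+ 5) ^+ 2.
have B0 : 0 <= B by rewrite divr_ge0 // exprn_ge0 // exprn_ge0 // ltW.
(* The first term makes the 3-graph large enough for admissibility, the second gives [d_large]. *)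
pose d := (n0 + (Num.bound B).+1)%N.
pose O := 'I_(level_size s).
pose W := ({ffun 'I_d -> 'I_s} * 'I_d)%type.
pose T := (O * W)%type.
(* Clusters and sides depend only on the first coordinate, so [unit] may replace [W], which itself
   involves the graph's vertex set [O] only through the product. *)
pose gO (r : 'I_s) (o o' : O) :=
  level_edge (@level_cluster s unit) (@level_side s unit) r (o, tt) (o', tt).
have Td : (d <= #|{: T}|)%N.
  rewrite !card_prod card_ffun !card_ord mulnA leq_pmull // muln_gt0.
  by rewrite level_size_gt0 expn_gt0 s0.
have T0 : (0 < #|{: T}|)%N by apply: leq_trans Td; rewrite /d addnS.
have [n [E [PE [nE [a [b [c [inja injb injc memE]]]]]]]] :=
  embed_bipartite (@blowup O 'I_d s gO) hP T0 hTrip.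
have n0n : (n0 <= n)%N.
  by rewrite nE; apply: leq_trans (leq_pmull _ _) => //; apply: leq_trans Td; exact: leq_addr.
have [Q [regQ QM]] := adm n E PE n0n.
have disc (S U : {set T}) : d%:R * (\sum_(x in S) \sum_(y in U)
    ((blowup gO x y)%:R -
       edge_weight s (@level_cluster s W) (@level_side s W) R x y)) ^+ 2 <= #|{: T}|%:R ^+ 4.
  by have := @discrepancy R O 'I_d s gO s0 S U; rewrite card_ord.
have d_large : (M%:R ^+ 2) ^+ 2 < d%:R * (e1 ^+ 5) ^+ 2.
  rewrite -ltr_pdivrMr ?exprn_gt0 //; apply: lt_le_trans (archi_boundP B0) _.
  by rewrite ler_nat /d addnS ltnW // ltnS leq_addl.
have s1 : 1 <= s%:R :> R by rewrite ler1n.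
have e1_small : e1 <= 1 / 100%:R.
  by move: s1 s_small; move: (s%:R : R) => s' h1 h2; nra.
by apply: (regular_partition_large inja injb injc memE disc T0 nE eps0 e10 e1_small
  eps_e1 QM d_large regQ (level_cluster_system s W) s0).
Qed.

End AdmissibleLower.

(** * Energy increment *)

Section Energy.

Local Open Scope ring_scope.
Variables (F : realFieldType) (T : finType) (f : T -> F).

Definition cell (K : eqType) (q : T -> K) t : {set T} := [set u | q u == q t].

Definition average (K : eqType) (q : T -> K) t : F :=
  (\sum_(u in cell q t) f u) / #|cell q t|%:R.

Definition energy (K : eqType) (q : T -> K) : F := \sum_t average q t ^+ 2.

Lemma card_cell_gt0 (K : eqType) (q : T -> K) t : (0 < #|cell q t|)%N.
Proof. by apply/card_gt0P; exists t; rewrite inE. Qed.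

Lemma cell_eq (K : eqType) (q : T -> K) t u : q t = q u -> cell q t = cell q u.
Proof. by move=> E; apply/setP => x; rewrite !inE E. Qed.

Lemma average_eq (K : eqType) (q : T -> K) t u : q t = q u -> average q t = average q u.
Proof. by move=> E; rewrite /average (cell_eq E). Qed.

(** [average q] is the conditional expectation of [f], tested here against a function constant on
    cells. *)
Lemma sum_average (K : eqType) (q : T -> K) (h : T -> F) :
  (forall t u, q t = q u -> h t = h u) ->
  \sum_t h t * average q t = \sum_t h t * f t.
Proof.
move=> hq.
transitivity (\sum_t \sum_u (if q u == q t then h u * f u / #|cell q u|%:R else 0)).
  apply: eq_bigr => t _; rewrite /average mulrA mulr_sumr mulr_suml big_mkcond.
  apply: eq_bigr => u _; rewrite inE; case: eqP => // E.
  by rewrite (hq _ _ E) (cell_eq E).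
rewrite exchange_big; apply: eq_bigr => u _ /=.
rewrite -big_mkcond /= sumr_const.
have -> : #|[pred t | q u == q t]| = #|cell q u|.
  by apply: eq_card => t; rewrite !inE eq_sym.
by rewrite -[LHS]mulr_natr divfK // pnatr_eq0 -lt0n card_cell_gt0.
Qed.

(** Pythagoras: the coarse average is the orthogonal projection of the fine one. *)
Lemma energy_refine (K K' : eqType) (q : T -> K) (q' : T -> K') :
  (forall t u, q' t = q' u -> q t = q u) ->
  energy q' = energy q + \sum_t (average q' t - average q t) ^+ 2.
Proof.
move=> qq'; rewrite /energy.
have E1 : \sum_t average q t * average q' t = \sum_t average q t * f t.
  by apply: sum_average => t u /qq'; apply: average_eq.
have E2 : \sum_t average q t * average q t = \sum_t average q t * f t.
  by apply: sum_average => t u; apply: average_eq.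
under [X in _ = _ + X]eq_bigr do rewrite sqrrB.
rewrite big_split sumrB /= sumrMnl.
under [X in _ - X *+ 2]eq_bigr do rewrite mulrC.
rewrite E1 -E2; under [X in _ - X *+ 2]eq_bigr do rewrite -expr2.
by rewrite mulr2n; ring.
Qed.

Hypothesis f01 : forall t, 0 <= f t <= 1.

Lemma energy_ge0 (K : eqType) (q : T -> K) : 0 <= energy q.
Proof. by apply: sumr_ge0 => t _; exact: sqr_ge0. Qed.

Lemma energy_le (K : eqType) (q : T -> K) : energy q <= #|T|%:R.
Proof.
rewrite /energy -sumr_const; apply: ler_sum => t _.
have c0 : 0 < #|cell q t|%:R :> F by rewrite ltr0n card_cell_gt0.
have a0 : 0 <= average q t.
  rewrite divr_ge0 ?ler0n // sumr_ge0 // => u _.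
  by case/andP: (f01 u).
have a1 : average q t <= 1.
  rewrite ler_pdivrMr // mul1r -sumr_const; apply: ler_sum => u _.
  by case/andP: (f01 u).
by rewrite expr_le1.
Qed.

(** [S] is a union of cells of [q'], so [f] may be replaced by [average q'] on it; then
    Cauchy-Schwarz applies. *)
Lemma sum_sqr_deviation (K K' : eqType) (q : T -> K) (q' : T -> K') t (S : {set T}) :
  S \subset cell q t -> (forall u u', q' u = q' u' -> (u \in S) = (u' \in S)) ->
  (\sum_(u in S) f u - average q t * #|S|%:R) ^+ 2 <=
  #|S|%:R * \sum_(u in S) (average q' u - average q u) ^+ 2.
Proof.
move=> /subsetP St Sq'; apply: le_trans (sqr_sum_le _ _).
rewrite sumrB.
have -> : \sum_(u in S) average q u = average q t * #|S|%:R.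
  rewrite mulr_natr -sumr_const; apply: eq_bigr => u /St.
  by rewrite inE => /eqP; apply: average_eq.
suff -> : \sum_(u in S) average q' u = \sum_(u in S) f u by [].
have := @sum_average _ q' (fun u => (u \in S)%:R).
have ind (h : T -> F) : \sum_u (u \in S)%:R * h u = \sum_(u in S) h u.
  rewrite [RHS]big_mkcond; apply: eq_bigr => u _.
  by case: (u \in S); rewrite ?mul1r ?mul0r.
by rewrite !ind; apply => u u' /Sq' ->.
Qed.

End Energy.

(** * One energy increment for 3-graphs *)

Section UpperBound.

Local Open Scope ring_scope.
Variables (V : finType) (E : {set {set V}}) (eps : R).
Hypotheses (eps_gt0 : 0 < eps) (V_gt0 : (0 < #|V|)%N).

Local Notation T := (V * V * V)%type.

Let f (t : T) : R := ([set t.1.1; t.1.2; t.2] \in E)%:R.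

Let f01 t : 0 <= f t <= 1.
Proof. by rewrite /f; case: (_ \in _); rewrite /= ?lexx ler01. Qed.

Definition label3 (L : finType) (p : V -> L) (t : T) : L * L * L :=
  (p t.1.1, p t.1.2, p t.2).

Definition reg_label3 (L : finType) (p : V -> L) (l : L * L * L) : Prop :=
  reg_triple E eps (fiber p l.1.1) (fiber p l.1.2) (fiber p l.2).

Lemma sum_box (X Y Z : {set V}) :
  \sum_(t in [set t : T | [&& t.1.1 \in X, t.1.2 \in Y & t.2 \in Z]]) f t =
  dens E X Y Z * #|[set t : T | [&& t.1.1 \in X, t.1.2 \in Y & t.2 \in Z]]|%:R.
Proof.
have -> : [set t : T | [&& t.1.1 \in X, t.1.2 \in Y & t.2 \in Z]] = setX (setX X Y) Z.
  by apply/setP => t; rewrite !inE andbA.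
rewrite !cardsX !natrM densE.
have -> : \sum_(t in setX (setX X Y) Z) f t =
  #|[set t : T | [&& t.1.1 \in X, t.1.2 \in Y & t.2 \in Z]
        && ([set t.1.1; t.1.2; t.2] \in E)]|%:R.
  rewrite /f -natr_sum; congr (_%:R).
  rewrite -sum1dep_card big_mkcond [RHS]big_mkcond; apply: eq_bigr => t _.
  by rewrite !inE andbA; case: (_ && (t.2 \in Z)) => //=; case: (_ \in E).
have [X0|X0] := posnP #|X|.
  rewrite X0 !(mul0r, mulr0); apply/eqP; rewrite pnatr_eq0 cards_eq0.
  by apply/eqP/setP => t; rewrite !inE (cards0_eq X0) inE.
have [Y0|Y0] := posnP #|Y|.
  rewrite Y0 !(mul0r, mulr0); apply/eqP; rewrite pnatr_eq0 cards_eq0.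
  by apply/eqP/setP => t; rewrite !inE (cards0_eq Y0) inE andbF.
have [Z0|Z0] := posnP #|Z|.
  rewrite Z0 !(mul0r, mulr0); apply/eqP; rewrite pnatr_eq0 cards_eq0.
  by apply/eqP/setP => t; rewrite !inE (cards0_eq Z0) inE !andbF.
by field; rewrite !pnatr_eq0 -!lt0n X0 Y0 Z0.
Qed.

Definition box (X Y Z : {set V}) : {set T} :=
  [set t : T | [&& t.1.1 \in X, t.1.2 \in Y & t.2 \in Z]].

Lemma cell_label3 (L : finType) (p : V -> L) t :
  cell (label3 p) t = box (fiber p (p t.1.1)) (fiber p (p t.1.2)) (fiber p (p t.2)).
Proof. by apply/setP => u; rewrite !inE /label3 !xpair_eqE andbA. Qed.

Lemma card_box (X Y Z : {set V}) : #|box X Y Z| = (#|X| * #|Y| * #|Z|)%N.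
Proof.
rewrite -!cardsX; apply: eq_card => t.
by rewrite !inE andbA.
Qed.

Lemma average_label3 (L : finType) (p : V -> L) t :
  average f (label3 p) t =
  dens E (fiber p (p t.1.1)) (fiber p (p t.1.2)) (fiber p (p t.2)).
Proof.
have c0 := card_cell_gt0 (label3 p) t.
rewrite /average; apply: (canLR (mulfK _)); first by rewrite pnatr_eq0 -lt0n.
by rewrite cell_label3 sum_box.
Qed.

(** The implication under the existential lets witnesses be chosen for all label triples at once. *)
Lemma irregular_witness (L : finType) (p : V -> L) (l : L * L * L) :
  exists W : {set V} * {set V} * {set V}, ~ reg_label3 p l ->
   [/\ [/\ W.1.1 \subset fiber p l.1.1, W.1.2 \subset fiber p l.1.2
         & W.2 \subset fiber p l.2],
       [/\ eps * #|fiber p l.1.1|%:R <= #|W.1.1|%:R,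
           eps * #|fiber p l.1.2|%:R <= #|W.1.2|%:R
         & eps * #|fiber p l.2|%:R <= #|W.2|%:R]
     & eps < `|dens E (fiber p l.1.1) (fiber p l.1.2) (fiber p l.2) -
               dens E W.1.1 W.1.2 W.2|].
Proof.
case: (classic (reg_label3 p l)) => [reg|nreg]; first by exists (set0, set0, set0).
apply: NNPP => none; apply: nreg; apply/reg_tripleP => X Y Z sX sY sZ hX hY hZ.
rewrite leNgt; apply/negP => lt; apply: none; exists (X, Y, Z) => _.
by split.
Qed.

(** The new label records, for each triple of old labels, membership in its three witnesses. A
    witness box fills [eps^3] of its cell and deviates by [eps], a gain of [eps^5] per element of
    the cell; irregular cells fill [eps] of the cube. *)
Lemma energy_increment (L : finType) (p : V -> L) :
  #|[set t : T | pb (reg_label3 p (label3 p t))]|%:R < (1 - eps) * #|V|%:R ^+ 3 ->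
  exists (L' : finType) (p' : V -> L'),
    #|L'| = (#|L| * 2 ^ (3 * #|L| ^ 3))%N /\
    energy f (label3 p) + eps ^+ 6 * #|V|%:R ^+ 3 <= energy f (label3 p').
Proof.
move=> irr; have [W HW] := fin_all_exists (irregular_witness p).
pose L3 := (L * L * L)%type.
pose p' x := (p x, ([set l : L3 | x \in (W l).1.1], [set l : L3 | x \in (W l).1.2],
   [set l : L3 | x \in (W l).2])).
exists (L * ({set L3} * {set L3} * {set L3}))%type, p'; split.
  have cs : #|{: {set L3}}| = (2 ^ (#|L| ^ 3))%N.
    transitivity #|powerset [set: L3]|; first by rewrite powersetT cardsT.
    by rewrite card_powerset cardsT !card_prod !expnS muln1 mulnA.
  by rewrite !card_prod cs -!expnD; congr (_ * 2 ^ _)%N; ring.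
rewrite (@energy_refine R _ f _ _ (label3 p) (label3 p')); last first.
  by move=> t u []; rewrite /label3 => -> _ _ _ -> _ _ _ -> _ _ _.
rewrite lerD2l.
pose S l := box (W l).1.1 (W l).1.2 (W l).2.
pose Irr := [set t : T | ~~ pb (reg_label3 p (label3 p t))].
have Sl t : t \in Irr -> S (label3 p t) \subset cell (label3 p) t /\
   eps ^+ 5 * #|cell (label3 p) t|%:R <=
   \sum_(u in S (label3 p t)) (average f (label3 p') u - average f (label3 p) u) ^+ 2.
  rewrite inE => /pbP /HW; set l := label3 p t => -[[s1 s2 s3] [c1 c2 c3] dev].
  have sub : S l \subset cell (label3 p) t.
    rewrite cell_label3; apply/subsetP => u; rewrite !inE => /and3P[h1 h2 h3].
    move/subsetP: s1 => /(_ _ h1); move/subsetP: s2 => /(_ _ h2).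
    by move/subsetP: s3 => /(_ _ h3); rewrite !inE => -> -> ->.
  split=> //.
  have meas u u' : label3 p' u = label3 p' u' -> (u \in S l) = (u' \in S l).
    case=> _ /setP e1 _ _ _ _ /setP e2 _ _ _ _ /setP e3.
    by move: (e1 l) (e2 l) (e3 l); rewrite !inE => -> -> ->.
  have := sum_sqr_deviation f sub meas.
  rewrite sum_box average_label3 -/(box _ _ _) -/(S l) -mulrBl.
  have fp x : 0 < #|fiber p (p x)|%:R :> R.
    by rewrite ltr0n; apply/card_gt0P; exists x; rewrite inE.
  have e0 := eps_gt0.
  have SC : eps ^+ 3 * #|cell (label3 p) t|%:R <= #|S l|%:R.
    rewrite cell_label3 !card_box !natrM.
    have -> : eps ^+ 3 * (#|fiber p (p t.1.1)|%:R * #|fiber p (p t.1.2)|%:R *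
       #|fiber p (p t.2)|%:R) = eps * #|fiber p (p t.1.1)|%:R *
        (eps * #|fiber p (p t.1.2)|%:R) * (eps * #|fiber p (p t.2)|%:R) :> R.
      by ring.
    by rewrite !ler_pM ?mulr_ge0 // ltW.
  have S0 : 0 < #|S l|%:R :> R.
    apply: lt_le_trans SC; rewrite mulr_gt0 ?exprn_gt0 // ltr0n.
    exact: card_cell_gt0.
  rewrite exprMn [in X in X <= _]expr2 [_%:R ^+ 2]expr2 mulrA.
  rewrite [X in X <= _]mulrC ler_pM2l //; apply: le_trans.
  apply: le_trans (_ : eps ^+ 2 * #|S l|%:R <= _).
    have -> : eps ^+ 5 = eps ^+ 2 * eps ^+ 3 by rewrite -exprD.
    by rewrite -mulrA ler_pM2l ?exprn_gt0.
  rewrite ler_pM2r //.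
  rewrite -expr2 -[X in _ <= X]real_normK ?num_real //.
  by rewrite ler_pXn2r ?nnegrE ?normr_ge0 ?(ltW e0) // distrC ltW.
have cIrr : eps * #|V|%:R ^+ 3 <= #|Irr|%:R.
  have := cardsC [set t : T | pb (reg_label3 p (label3 p t))].
  have -> : ~: [set t : T | pb (reg_label3 p (label3 p t))] = Irr.
    by apply/setP => t; rewrite !inE.
  rewrite !card_prod => /(congr1 (fun k => k%:R : R)); rewrite natrD !natrM.
  by move: irr; rewrite exprSr expr2; lra.
apply: le_trans (_ : eps ^+ 5 * #|Irr|%:R <= _).
  by rewrite exprSr -mulrA ler_pM2l // exprn_gt0.
rewrite (partition_big (label3 p) predT) //=.
rewrite -sum1_card natr_sum mulr_sumr (partition_big (label3 p) predT) //=.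
apply: ler_sum => l _.
have [t /andP[tI /eqP tl]|none] := pickP [pred t | (t \in Irr) && (label3 p t == l)];
    last first.
  by rewrite big1 ?sumr_ge0 // => t => [_|]; [exact: sqr_ge0|rewrite [_ && _]none].
have [sub dev] := Sl t tI; rewrite tl in sub dev.
apply: le_trans (_ : eps ^+ 5 * #|cell (label3 p) t|%:R <= _).
  rewrite -mulr_sumr ler_pM2l ?exprn_gt0 // -natr_sum sum1dep_card ler_nat.
  apply/subset_leq_card/subsetP => u; rewrite !inE tl => /andP[_ ->] //.
apply: le_trans dev _; rewrite [X in X <= _]big_mkcond [X in _ <= X]big_mkcond /=.
apply: ler_sum => u _; case: ifP => [uS|_]; last by case: ifP => // _; exact: sqr_ge0.
by move/subsetP: sub => /(_ u uS); rewrite inE tl => ->.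
Qed.

End UpperBound.

(** * Iteration of the increment and tower bound *)

Section RegularityLemma.

Local Open Scope ring_scope.

Lemma Tw_mono i j : (i <= j)%N -> (Tw i <= Tw j)%N.
Proof.
have step k : (Tw k <= Tw k.+1)%N by case: k => //= k; rewrite ltnW // ltn_expl.
elim: j => [|j IH]; first by rewrite leqn0 => /eqP ->.
rewrite leq_eqVlt => /orP[/eqP -> //|/IH le].
exact: leq_trans (step j).
Qed.

(** The exponent is at most [q + 3 q^3 <= 4 q^3 <= 2 ^ (3 q)], and [3 q <= 2 ^ (2 ^ q)]. One
    increment therefore costs four levels of the tower. *)
Lemma tower_step q : (0 < q)%N -> (q * 2 ^ (3 * q ^ 3) <= 2 ^ (2 ^ (2 ^ (2 ^ q))))%N.
Proof.
have dbl k : (0 < k)%N -> (2 * k <= 2 ^ k)%N.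
  case: k => // k _; elim: k => // k IH.
  by rewrite expnS leq_mul2l /=; apply: leq_trans IH; lia.
move=> q0; have h1 := dbl q q0.
have h2 := dbl (2 ^ q)%N (expn_gt0 2 q); have h3 := dbl _ (expn_gt0 2 (2 ^ q)).
have hq : (q <= 2 ^ q)%N by rewrite ltnW // ltn_expl.
have h4 : (4 * q ^ 3 <= 2 ^ (3 * q))%N.
  have : (2 ^ 3 * q ^ 3 <= 2 ^ (3 * q))%N.
    by rewrite -expnMn (mulnC 3) expnM leq_exp2r.
  by apply: leq_trans; rewrite leq_mul2r orbT.
apply: leq_trans (_ : 2 ^ (q + 3 * q ^ 3) <= _)%N.
  by rewrite expnD leq_mul2r hq orbT.
rewrite leq_exp2l //; apply: leq_trans (_ : 2 ^ (3 * q) <= _)%N.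
  apply: leq_trans h4; have : (q <= q ^ 3)%N by rewrite -{1}[q]expn1 leq_pexp2l.
  by lia.
by rewrite leq_exp2l //; lia.
Qed.

Variables (n : nat) (E : {set {set 'I_n}}) (eps : R).
Hypotheses (eps_gt0 : 0 < eps) (n_gt0 : (0 < n)%N).

Lemma regular_labelling k : exists (L : finType) (p : 'I_n -> L),
  (#|L| <= Tw (1 + 4 * k))%N /\
  ((1 - eps) * n%:R ^+ 3 <=
     #|[set t : 'I_n * 'I_n * 'I_n | pb (reg_label3 E eps p (label3 p t))]|%:R \/
   k%:R * eps ^+ 6 * n%:R ^+ 3 <=
     energy (fun t : 'I_n * 'I_n * 'I_n =>
       ([set t.1.1; t.1.2; t.2] \in E)%:R : R) (label3 p)).
Proof.
elim: k => [|k [L [p [cL [reg|en]]]]].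
- exists unit, (fun=> tt); rewrite card_unit; split=> //; right.
  by rewrite !mul0r energy_ge0.
- exists L, p; split; last by left.
  by apply: leq_trans cL _; apply: Tw_mono; rewrite leq_add2l leq_mul2l leqnSn orbT.
have n0 : (0 < #|'I_n|)%N by rewrite card_ord.
have [reg|irr] := leP ((1 - eps) * n%:R ^+ 3)
  #|[set t : 'I_n * 'I_n * 'I_n | pb (reg_label3 E eps p (label3 p t))]|%:R.
  exists L, p; split; last by left.
  by apply: leq_trans cL _; apply: Tw_mono; rewrite leq_add2l leq_mul2l leqnSn orbT.
have [|L' [p' [cL' en']]] := @energy_increment _ E eps eps_gt0 L p.
  by rewrite card_ord.
exists L', p'; split; last first.
  right; apply: le_trans en'; rewrite card_ord -natr1 mulrDl mulrDl mul1r.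
  by rewrite lerD2r.
rewrite cL'.
have L0 : (0 < #|L|)%N by apply/card_gt0P; exists (p (Ordinal n_gt0)).
apply: leq_trans (tower_step L0) _.
have -> : (1 + 4 * k.+1 = (1 + 4 * k).+4)%N by lia.
by rewrite /= !leq_exp2l.
Qed.

(** The energy never exceeds [n^3], so the second outcome of [regular_labelling] is impossible. *)
Theorem weak_regularity k : 1 < k%:R * eps ^+ 6 ->
  exists Q : {set {set 'I_n}}, reg_partition E eps Q /\ (#|Q| <= Tw (1 + 4 * k))%N.
Proof.
move=> k_large; have [L [p [cL reg]]] := regular_labelling k.
have {}reg : (1 - eps) * n%:R ^+ 3 <=
   #|[set t : 'I_n * 'I_n * 'I_n | pb (reg_label3 E eps p (label3 p t))]|%:R.
  case: reg => // en; exfalso.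
  have n3 : 0 < n%:R ^+ 3 :> R by rewrite exprn_gt0 // ltr0n.
  have f01 (t : 'I_n * 'I_n * 'I_n) : 0 <= (([set t.1.1; t.1.2; t.2] \in E)%:R : R) <= 1.
    by case: (_ \in E); rewrite /= ?lexx ler01.
  have := le_trans en (energy_le f01 _); rewrite !card_prod card_ord !natrM.
  have : 1 * n%:R ^+ 3 < k%:R * eps ^+ 6 * n%:R ^+ 3 by rewrite ltr_pM2r.
  by rewrite !exprS expr0 mulr1; lra.
exists (preim_partition p setT); split.
  split; first exact: preim_partitionP.
  rewrite !INRE RpowE RmultE RminusE R1E card_ord; apply/RleP.
  apply: le_trans reg _; rewrite ler_nat; apply/subset_leq_card/subsetP => t.
  rewrite !inE => /pbP reg; apply/pbP.
  have inQ x : fiber p (p x) \in preim_partition p setT.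
    apply/imsetP; exists x; rewrite ?inE //.
    by apply/setP => y; rewrite !inE eq_sym.
  exists (fiber p (p t.1.1)), (fiber p (p t.1.2)), (fiber p (p t.2)).
  by split=> //; rewrite !inE !eqxx.
apply: leq_trans cL; rewrite -[#|L|]cardsT.
apply: leq_trans (leq_imset_card (fiber p) _); apply/subset_leq_card/subsetP => X.
case/imsetP=> x _ ->; apply/imsetP; exists (p x) => //.
by apply/setP => y; rewrite !inE eq_sym.
Qed.

End RegularityLemma.

(** * Ceilings and real powers *)

Section Ceiling.

Local Open Scope ring_scope.

Lemma ceilR_ge (x : R) : x <= (ceilR x)%:R.
Proof.
have [/RleP h1 _] := base_Int_part (Ropp x).
rewrite -INRE INR_IZR_INZ /ceilR ZifyInst.of_nat_to_nat_eq.
apply: le_trans (_ : IZR (- Int_part (- x)%R) <= _); first by rewrite opp_IZR RoppE; move: h1; rewrite RoppE; lra.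
by apply/RleP/IZR_le; exact: Z.le_max_r.
Qed.

Lemma ceilR_le (x : R) : 0 <= x -> (ceilR x)%:R <= x + 1.
Proof.
move=> x0; have [_ h2] := base_Int_part (Ropp x).
have {}h2 : IZR (- Int_part (- x)%R) <= x + 1.
  move/Rgt_lt/RltP: h2; rewrite RminusE RoppE opp_IZR RoppE.
  have -> : IZR (Zneg xH) = - 1 :> R by [].
  by move: (IZR _) => i; lra.
rewrite -INRE INR_IZR_INZ /ceilR ZifyInst.of_nat_to_nat_eq.
case: (Z.max_spec 0 (- Int_part (Ropp x))) => -[_ ->] //.
by rewrite R0E addr_ge0.
Qed.

Lemma Rpower_invE (eps : R) k : 0 < eps -> (0 < k)%N ->
  Rpower eps (- k%:R^-1) ^+ k = eps^-1.
Proof.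
move=> e0 k0; have y0 : Rlt 0 (Rpower eps (- k%:R^-1)) by exact: exp_pos.
rewrite -RpowE -Rpower_pow // Rpower_mult INRE RmultE mulNr mulVf; last first.
  by rewrite pnatr_eq0 -lt0n.
by rewrite -RoppE Rpower_Ropp Rpower_1 //; apply/RltP.
Qed.

Lemma Rpower_natNE (eps : R) k : 0 < eps -> Rpower eps (- k%:R) = eps^-1 ^+ k.
Proof.
by move=> /RltP e0; rewrite Rpower_Ropp -INRE Rpower_pow // RpowE exprVn.
Qed.

End Ceiling.

(** * Tower bounds in terms of [eps] *)

Section Bounds.

Local Open Scope ring_scope.

(** With [y = eps^(-1/5)], the number of levels is [s <= 9 y] and [e1] is the largest value allowed,
    of order [s^-2]. Then [eps <= e1^2] follows from [C y^4 <= y^5], where 81 is [9^2]. *)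
Lemma admissible_tower_lower (P : prop3) (eps : R) (M : nat) :
  hereditary3 P -> (forall k, (1 <= k)%N -> trip_contains P (kUk_edges k)) ->
  0 < eps ->
  (64%:R * 200%:R * 100%:R * 81%:R) ^+ 2 < Rpower eps (- 5%:R^-1) ->
  MH_admissible P eps M -> (TwR (Rpower eps (- 5%:R^-1)) <= M)%N.
Proof.
move=> hP hTrip e0; have := Rpower_invE e0 (isT : (0 < 5)%N).
set y := Rpower _ _ => y5; set C : R := _ ^+ 2 => Cy adm.
pose h := ceilR y; pose s := (3 + 3 * h)%N.
have C1 : 1 <= C by rewrite /C; lra.
have y0 : 0 <= y by lra.
have hy : h%:R <= y + 1 by apply: ceilR_le; lra.
have sy : s%:R <= 9%:R * y by rewrite /s natrD natrM; lra.
have s1 : 1 <= s%:R :> R by rewrite ler1n.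
have S0 : 0 < 64%:R * 200%:R * 100%:R * s%:R ^+ 2 :> R.
  by rewrite mulr_gt0 ?exprn_gt0 //; lra.
have [_ tower] := level_size_tower h.
rewrite -(@leq_pmul2l 4) //; apply: leq_trans tower _.
apply: (@admissible_lower P s M eps (64%:R * 200%:R * 100%:R * s%:R ^+ 2)^-1) => //.
- by rewrite invr_gt0.
- rewrite exprVn -[eps]invrK lef_pV2 ?posrE ?invr_gt0 ?exprn_gt0 // -y5.
  apply: le_trans (_ : C * y ^+ 4 <= _); last first.
    by rewrite [X in _ <= X]exprS ler_wpM2r ?exprn_ge0 ?(ltW Cy).
  have -> : C * y ^+ 4 = (64%:R * 200%:R * 100%:R * (9%:R * y) ^+ 2) ^+ 2.
    by rewrite /C; ring.
  have S1 : 0 <= 64%:R * 200%:R * 100%:R * (9%:R * y) ^+ 2.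
    by apply: mulr_ge0; [lra | rewrite exprn_ge0 // mulr_ge0].
  rewrite ler_pXn2r ?nnegrE ?(ltW S0) ?S1 // ler_pM2l; last by lra.
  by rewrite ler_pXn2r ?nnegrE ?mulr_ge0.
- have -> : 64%:R * 200%:R * s%:R ^+ 2 *
     (100%:R * (64%:R * 200%:R * 100%:R * s%:R ^+ 2)^-1) = 1 :> R; last by [].
  by field; rewrite ?gt_eqF //; lra.
Qed.

Lemma admissible_tower_upper (P : prop3) (eps : R) :
  0 < eps -> 13%:R <= eps^-1 ->
  exists2 M, MH_admissible P eps M & (M <= TwR (Rpower eps (- 7%:R)))%N.
Proof.
move=> e0 x13; rewrite Rpower_natNE //; set x := eps^-1 in x13 *.
(* The successor makes [k * eps^6 > 1] strict; then [1 + 4 k <= 4 x^6 + 9 <= 13 x^6 <= x^7]. *)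
pose k := (ceilR (x ^+ 6)).+1.
have x0 : 0 < x by lra.
have x6 : 0 <= x ^+ 6 by rewrite exprn_ge0 // ltW.
have k_gt : x ^+ 6 < k%:R by apply: le_lt_trans (ceilR_ge _) _; rewrite ltr_nat.
have k_le : k%:R <= x ^+ 6 + 2%:R by rewrite /k -natr1 mulr2n addrA lerD2r ceilR_le.
exists (Tw (1 + 4 * k)).
  exists 1%N => n E _ n0; apply: weak_regularity => //.
  by rewrite -ltr_pdivrMr ?exprn_gt0 // mul1r -exprVn.
apply: Tw_mono; rewrite -(ler_nat R); apply: le_trans (ceilR_ge _).
have x61 : 1 <= x ^+ 6 by rewrite exprn_ege1 //; lra.
have : 13%:R * x ^+ 6 <= x ^+ 7 by rewrite exprS ler_wpM2r.
by rewrite natrD natrM; lra.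
Qed.

End Bounds.

Theorem theorem5p4 (P : prop3) (hP : hereditary3 P)
  (hTrip : forall k : nat, (1 <= k)%N -> trip_contains P (kUk_edges k)) :
  exists K K' : R, Rlt 0 K /\ Rlt 0 K' /\
    exists eps0 : R, Rlt 0 eps0 /\
      forall eps : R, Rlt 0 eps -> Rlt eps eps0 ->
        exists M : nat, is_MH P eps M /\
          (TwR (Rpower eps (Ropp K)) <= M <= TwR (Rpower eps (Ropp K')))%N.
Proof.
(* [C] comes with an equation so that this large constant stays a variable in the arithmetic. *)
have [C [CE C13]] : exists C : R,
    C = ((64%:R * 200%:R * 100%:R * 81%:R) ^+ 2)%R /\ (13%:R <= C)%R.
  by eexists; split; [reflexivity | lra].
have C0 : (0 < C)%R by lra.
exists (5%:R^-1)%R, (7%:R)%R; split; first by apply/RltP; rewrite invr_gt0.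
split; first exact/RltP.
(* Below this threshold [eps^(-1/5) > C] and [eps^-1 > 13], as the two bounds require. *)
exists ((C ^+ 5)^-1)%R; split; first by apply/RltP; rewrite invr_gt0 exprn_gt0.
move=> eps /RltP e0 /RltP eC.
have CV : (C ^+ 5 < eps^-1)%R by rewrite -[(C ^+ 5)%R]invrK ltf_pV2 ?posrE ?invr_gt0 ?exprn_gt0.
have CC : (C <= C ^+ 5)%R by rewrite ler_eXnr //; lra.
have [|M0 adm0 M0_le] := @admissible_tower_upper P eps e0; first by lra.
(* The upper bound supplies an admissible number, so a least one exists. *)
have ex : exists M, pb (MH_admissible P eps M) by exists M0; apply/pbP.
case: (ex_minnP ex) => M /pbP admM minM; exists M; split.
  by split=> // M' /pbP; exact: minM.
apply/andP; split; last by apply: leq_trans M0_le; apply: minM; apply/pbP.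
have lt : (C < Rpower eps (- 5%:R^-1))%R.
  rewrite ltNge; apply/negP => le; move: CV; rewrite ltNge => /negP; apply.
  rewrite -(Rpower_invE e0 (isT : (0 < 5)%N)) ler_pXn2r ?nnegrE ?(ltW C0) //.
  by apply/ltW/RltP; exact: exp_pos.
apply: (admissible_tower_lower hP hTrip e0 _ admM).
by move: lt; rewrite CE; apply.
Qed.
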